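(* Let $X$ be a metric space, let $\mu$ be an admissible measure on $X$, and let $\bar\nu_\mu:L^c(X)\to[0,1]$ be the additive extension of $\hat\nu_\mu:E(M^c(X))\to[0,1]$ to the Boolean algebra $L^c(X)$. Then $\bar\nu_\mu$ extends to a unique $\sigma$-additive measure $\nu_\mu$ on the $\sigma$-algebra generated by the clopen subsets of $\widehat X^c$, i.e. there is a unique $\sigma$-additive measure $\nu_\mu$ on this $\sigma$-algebra such that $\nu_\mu(U_a)=\bar\nu_\mu(a)$ for every $a\in L^c(X)$.
   Context: Let $(X,d_X)$ be a metric space. Write $x$ for $(x,0)$ and $x'$ for $(x,1)$ in $X\times\{0,1\}$. $\mathcal M(X)$ is the set of all metrics $d$ on $X\times\{0,1\}$ whose restriction to each copy of $X$ equals $d_X$ and with $\inf_{x,y\in X}d(x,y')>0$. Metrics $d_1,d_2\in\mathcal M(X)$ are coarse equivalent if there exist monotone functions $\varphi,\psi:[0,\infty)\to[0,\infty)$ tending to $\infty$ at $\infty$ with $\varphi(d_1(x,y'))\le d_2(x,y')\le\psi(d_1(x,y'))$ for all $x,y\in X$. $M^c(X)$ is the set of classes $[d]_c$; it is an inverse semigroup under $[\rho]_c[d]_c=[\rho d]_c$, $(\rho d)(x,y')=\inf_{z\in X}[d(x,z')+\rho(z,y')]$. $E(M^c(X))$ is its set of idempotents; each idempotent class has a selfadjoint representative ($d(x,y')=d(y,x')$) and is determined by the coarse equivalence class of the function $x\mapsto d(x,x')$. $E(M^c(X))$ is a distributive lattice: for $p=[d_1]_c$, $q=[d_2]_c$ with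 $d_i$ selfadjoint, $p\land q=pq$ and $p\lor q$ are the idempotents whose functions are coarse equivalent to $x\mapsto\max(d_1(x,x'),d_2(x,x'))$ and $x\mapsto\min(d_1(x,x'),d_2(x,x'))$. The minimal element $\mathbf 0$ is the class of $d_X(x,x_0)+1+d_X(x_0,y)$ (any $x_0\in X$); the maximal element $\mathbf 1$ is represented by $d_X(x,y)+1$. $L^c(X)$ is the Boolean algebra generated by this lattice: finite formal mod 2 sums of elements of $E(M^c(X))\setminus\{\mathbf 0\}$, with $\land$ extended linearly ($\mathbf 0$ being the empty sum), modulo the ideal generated by all $e+f+e\land f+e\lor f$; the complement is $\overline a=\mathbf 1+a$. $\widehat X^c$ is the Stone space of $L^c(X)$ (Boolean homomorphisms $L^c(X)\to\mathbb Z/2$ with pointwise convergence), and $U_a=\{\varphi\in\widehat X^c:\varphi(a)=1\}$ is the clopen set corresponding to $a\in L^c(X)$. An admissible measure on $X$ is a map $\mu:Cl(X)\to[0,1]$ on the closed subsets of $X$ such that (am1) $\mu$ is a finitely additive probability measure (monotone, $\mu(\emptyset)=0$, $\mu(X)=1$, $\mu(A\cap B)+\mu(A\cup B)=\mu(A)+\mu(B)$); (am2) $\mu(K)=0$ for any bounded closed $K\subset X$. For $a\in E(M^c(X))$ with selfadjoint representative $d$ and $A_n=\{x\in X:d(x,x')\le n\}$, $\hat\nu_\mu(a)=\lim_{n\to\infty}\mu(A_n)$, which is independent of the choice of $d$. The (well-defined) extension $\bar\nu_\mu$ is $$\bar\nu_\mu(e_1+\cdots+e_n)=\sum_{i=1}^n(-2)^{i-1}\sum_{1\le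 j_1<\cdots<j_i\le n}\hat\nu_\mu(e_{j_1}\land\cdots\land e_{j_i}),\quad e_j\in E(M^c(X)),$$ and it satisfies $\bar\nu_\mu(\mathbf 1)=1$, $\bar\nu_\mu(\overline a)=1-\bar\nu_\mu(a)$, $\bar\nu_\mu(a\land b)+\bar\nu_\mu(a\lor b)=\bar\nu_\mu(a)+\bar\nu_\mu(b)$ for $a,b\in L^c(X)$. *)

(* Defs.v *)
From HB Require Import structures.
From mathcomp Require Import all_boot all_order all_algebra.
From mathcomp Require Import finmap generic_quotient ring_quotient.
From mathcomp.multinomials Require Import monalg.
From mathcomp Require Import all_classical all_reals all_analysis.
From mathcomp Require Import lra.

Set Implicit Arguments.
Unset Strict Implicit.
Unset Printing Implicit Defensive.

Import Order.TTheory GRing.Theory Num.Theory.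
Import numFieldNormedType.Exports.

Local Open Scope classical_set_scope.
Local Open Scope ring_scope.
Local Open Scope quotient_scope.

Section CoarseFunctions.
Context {R : realType}.

(* [phi] stands for a monotone map from [0, +oo[ to itself that tends to      *)
(* infinity; its values at negative numbers are irrelevant.                   *)
Definition coarse_gauge (phi : R -> R) : Prop :=
  [/\ forall t, 0 <= t -> 0 <= phi t,
      forall s t, 0 <= s -> s <= t -> phi s <= phi t &
      phi t @[t --> +oo] --> +oo].

Definition coarse_eq (T : Type) (f g : T -> R) : Prop :=
  exists phi psi, [/\ coarse_gauge phi, coarse_gauge psi &
    forall t, phi (f t) <= g t /\ g t <= psi (f t)].

Definition coarse_ctrl (T : Type) (f g : T -> R) : Prop :=
  forall M, exists N, forall t, f t <= M -> g t <= N.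

Lemma coarse_ctrl_refl T (f : T -> R) : coarse_ctrl f f.
Proof. by move=> M; exists M. Qed.

Lemma coarse_ctrl_trans T (g f h : T -> R) :
  coarse_ctrl f g -> coarse_ctrl g h -> coarse_ctrl f h.
Proof.
move=> fg gh M; have [N fgN] := fg M; have [K ghK] := gh N.
by exists K => t /fgN/ghK.
Qed.

Lemma coarse_ctrl_gauge T (f g : T -> R) :
    (forall t, 0 <= f t) -> (forall t, 0 <= g t) -> coarse_ctrl f g ->
  exists psi : R -> R, [/\ coarse_gauge psi, forall t, 0 <= t -> t <= psi t &
    forall t, g t <= psi (f t)].
Proof.
move=> f0 g0 fg; pose S s := [set y | y = 0 \/ exists2 t, f t <= s & y = g t].
have supS s : has_sup (S s).
  split; first by exists 0; left.
  have [N fgN] := fg s; exists (Num.max N 0) => _ [->|[t fts ->]].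
    by rewrite le_max lexx orbT.
  by rewrite le_max fgN.
have S0 s : 0 <= sup (S s).
  by apply: sup_upper_bound => //; left.
exists (fun s => s + sup (S s)); split; last 2 first.
- by move=> t _; rewrite lerDl.
- move=> t; rewrite -[leLHS]add0r lerD//; apply: sup_upper_bound => //.
  by right; exists t.
split.
- by move=> t t0; rewrite addr_ge0.
- move=> s t _ st; rewrite lerD//; apply: ge_sup; first by case: (supS s).
  move=> y yS; apply: sup_upper_bound => //.
  by case: yS => [->|[u us ->]]; [left|right; exists u => //; exact: le_trans st].
- apply/cvgryPge => A; near=> t; rewrite -[leLHS]addr0 lerD//.
Unshelve. all: by end_near. Qed.

Lemma coarse_eqP T (f g : T -> R) :
    (forall t, 0 <= f t) -> (forall t, 0 <= g t) ->
  coarse_eq f g <-> coarse_ctrl f g /\ coarse_ctrl g f.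
Proof.
move=> f0 g0; split.
  move=> [phi [psi [[phi0 phim /cvgryPgt phioo] [psi0 psim _] fg]]]; split=> M.
    exists (psi M) => t ftM; apply: le_trans (psim _ _ (f0 t) ftM).
    by have [] := fg t.
  have [K [_ KM]] := phioo M.
  pose K' := Num.max K 0 + 1; exists K' => t gtM; rewrite leNgt; apply/negP => K'f.
  have [+ _] := fg t; apply/negP; rewrite -ltNge (le_lt_trans gtM)//.
  apply: KM; apply: lt_trans K'f.
  by rewrite /K' (@le_lt_trans _ _ (Num.max K 0)) ?le_max ?lexx// ltrDl.
move=> [/(coarse_ctrl_gauge f0 g0)[psi [gpsi psi_id fpsi]]].
move=> /(coarse_ctrl_gauge g0 f0)[chi [[chi0 chim _] chi_id gchi]].
pose I r := [set s | 0 <= s /\ r <= chi s].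
have infI r : has_inf (I r).
  split; last by exists 0 => s [].
  exists (Num.max r 0); split; first by rewrite le_max lexx orbT.
  by apply: le_trans (chi_id _ _); rewrite le_max lexx ?orbT.
exists (fun r => inf (I r)), psi; split => //; last first.
  move=> t; split => //; apply: inf_lbound; last by split.
  by case: (infI (f t)).
split.
- by move=> r r0; apply: lb_le_inf; [case: (infI r)|move=> s []].
- move=> r s r0 rs; apply: lb_le_inf; first by case: (infI s).
  move=> u [u0 su]; apply: inf_lbound; first by case: (infI r).
  by split => //; exact: le_trans su.
- apply/cvgryPge => A; near=> r; apply: lb_le_inf; first by case: (infI r).
  move=> s [s0 rs]; rewrite leNgt; apply/negP => sA.
  have := chim _ _ s0 (ltW sA); apply/negP; rewrite -ltNge.
  apply: lt_le_trans rs; near: r; apply: nbhs_pinfty_gt; exact: num_real.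
Unshelve. all: by end_near. Qed.

End CoarseFunctions.

Section Ideal.
Variables (A : comNzRingType) (S : set A).

Definition ideal_generated : set A :=
  [set a | exists n (r s : 'I_n -> A),
     (forall i, S (s i)) /\ a = \sum_i r i * s i].

Definition ideal_pred : {pred A} := fun a => `[< ideal_generated a >].

Lemma ideal_pred_mul a b : b \in ideal_pred -> a * b \in ideal_pred.
Proof.
move=> /asboolP[n [r [s [Ss ->]]]]; apply/asboolP.
exists n, (fun i => a * r i), s; split => //.
by rewrite mulr_sumr; apply: eq_bigr => i _; rewrite mulrA.
Qed.

Lemma ideal_pred_zmod : zmod_closed ideal_pred.
Proof.
split.
  apply/asboolP; exists 0%N, (fun=> 0), (fun=> 0); split; first by case.
  by rewrite big_ord0.
move=> a b /asboolP[n [r [s [Ss ->]]]] /asboolP[m [r' [s' [Ss' ->]]]].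
apply/asboolP; exists (n + m)%N.
exists (fun i => match fintype.split i with inl j => r j | inr j => - r' j end).
exists (fun i => match fintype.split i with inl j => s j | inr j => s' j end).
split; first by move=> i; case: (fintype.split i).
rewrite big_split_ord /= -sumrN; congr (_ + _); apply: eq_bigr => i _.
  by rewrite (unsplitK (inl i)).
by rewrite (unsplitK (inr i)) mulNr.
Qed.

End Ideal.

Section Metrics.
Context {R : realType} (X : metricType R).
Local Notation dX := (@mdist R X).

(* The set M(X): the point [x] is [(x, false)] and [x'] is [(x, true)].       *)
(* The infimum is taken in [\bar R] so that it is [+oo] when [X] is empty.    *)
Record dbl_metric := DblMetric {
  dm :> X * bool -> X * bool -> R;
  dm_ge0 : forall u v, 0 <= dm u v;
  dm_eq0 : forall u v, dm u v = 0 <-> u = v;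
  dm_sym : forall u v, dm u v = dm v u;
  dm_triangle : forall v u w, dm u w <= dm u v + dm v w;
  dm_copy : forall b x y, dm (x, b) (y, b) = dX x y;
  dm_gap : (0 < ereal_inf
    [set (dm (x, false) (y, true))%:E | x in [set: X] & y in [set: X]])%E }.

HB.instance Definition _ := gen_eqMixin dbl_metric.
HB.instance Definition _ := gen_choiceMixin dbl_metric.

(* [cross d x y] is $d(x, y')$ and [diag d x] is $d(x, x')$.                  *)
Definition cross (d : dbl_metric) (x y : X) : R := d (x, false) (y, true).
Definition diag (d : dbl_metric) (x : X) : R := cross d x x.

Arguments cross : simpl never.
Arguments diag : simpl never.

Definition selfadjoint (d : dbl_metric) := forall x y, cross d x y = cross d y x.

Definition coarse_equiv (d1 d2 : dbl_metric) : Prop :=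
  coarse_eq (fun p : X * X => cross d1 p.1 p.2)
            (fun p : X * X => cross d2 p.1 p.2).

Lemma cross_ge0 d x y : 0 <= cross d x y. Proof. exact: dm_ge0. Qed.

Lemma cross_gap d : exists2 e, 0 < e & forall x y, e <= cross d x y.
Proof.
have := dm_gap d; set S := (S in ereal_inf S) => S0.
have lbS x y : (ereal_inf S <= (cross d x y)%:E)%E.
  by apply: ereal_inf_lbound; exists x => //; exists y.
case: (ereal_inf S) S0 lbS => [e||//] e0 lbS.
- by exists e; [move: e0; rewrite lte_fin|move=> x y; rewrite -lee_fin].
- by exists 1 => // x y; have := lbS x y; rewrite leye_eq.
Qed.

Lemma cross_l d z x y : cross d x y <= dX x z + cross d z y.
Proof. by rewrite -(dm_copy d false) dm_triangle. Qed.

Lemma cross_r d z x y : cross d x y <= cross d x z + dX z y.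
Proof. by rewrite -(dm_copy d true) dm_triangle. Qed.

Lemma dist_crossl d y x z : dX x z <= cross d x y + cross d z y.
Proof.
by rewrite -(dm_copy d false) {2}/cross (dm_sym _ (z, _)) dm_triangle.
Qed.

Lemma dist_crossr d y x z : dX x z <= cross d y x + cross d y z.
Proof.
by rewrite -(dm_copy d true) {1}/cross (dm_sym _ (y, _)) dm_triangle.
Qed.

Section Build.
Variable c : X -> X -> R.
Hypothesis c_gap : exists2 e, 0 < e & forall x y, e <= c x y.
Hypothesis c_l : forall z x y, c x y <= dX x z + c z y.
Hypothesis c_r : forall z x y, c x y <= c x z + dX z y.
Hypothesis dist_cl : forall y x z, dX x z <= c x y + c z y.
Hypothesis dist_cr : forall y x z, dX x z <= c y x + c y z.

Let m (u v : X * bool) : R :=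
  match u.2, v.2 with
  | false, true => c u.1 v.1
  | true, false => c v.1 u.1
  | _, _ => dX u.1 v.1
  end.

Let c_gt0 x y : 0 < c x y.
Proof. by have [e e0 ec] := c_gap; exact: lt_le_trans (ec _ _). Qed.

Let m_ge0 u v : 0 <= m u v.
Proof.
by case: u v => x [] [y []]; rewrite /m/= ?mdist_ge0// ltW.
Qed.

Let m_eq0 u v : m u v = 0 <-> u = v.
Proof.
case: u v => x [] [y []]; rewrite /m/=; split.
- by move/mdist_positivity->.
- by move=> [->]; exact: mdistxx.
- by move=> c0; have := c_gt0 y x; rewrite c0 ltxx.
- by [].
- by move=> c0; have := c_gt0 x y; rewrite c0 ltxx.
- by [].
- by move/mdist_positivity->.
- by move=> [->]; exact: mdistxx.
Qed.

Let m_sym u v : m u v = m v u.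
Proof. by case: u v => x [] [y []]; rewrite /m//=; exact: metric_sym. Qed.

Let m_triangle v u w : m u w <= m u v + m v w.
Proof.
case: u v w => x [] [y []] [z []]; rewrite /m/=; do ?exact: metric_triangle.
- by rewrite addrC (metric_sym x); exact: c_r.
- exact: dist_cr.
- by rewrite addrC (metric_sym y); exact: c_l.
- exact: c_r.
- exact: dist_cl.
- exact: c_l.
Qed.

Let m_copy b x y : m (x, b) (y, b) = dX x y. Proof. by case: b. Qed.

Let m_gap : (0 < ereal_inf
  [set (m (x, false) (y, true))%:E | x in [set: X] & y in [set: X]])%E.
Proof.
have [e e0 ec] := c_gap; apply: (@lt_le_trans _ _ e%:E); first by rewrite lte_fin.
by apply: le_ereal_inf_tmp => _ [x _ [y _ <-]]; rewrite lee_fin; exact: ec.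
Qed.

Definition dbl_of_cross : dbl_metric :=
  DblMetric m_ge0 m_eq0 m_sym m_triangle m_copy m_gap.

Lemma dbl_of_crossE x y : cross dbl_of_cross x y = c x y. Proof. by []. Qed.

End Build.

Definition comp_cross (rho d : dbl_metric) (x y : X) : R :=
  inf [set cross d x z + cross rho z y | z in [set: X]].

Lemma comp_has_inf rho d x y :
  has_inf [set cross d x z + cross rho z y | z in [set: X]].
Proof.
split; first by exists (cross d x x + cross rho x y); exists x.
by exists 0 => _ [z _ <-]; rewrite addr_ge0 ?cross_ge0.
Qed.

Lemma comp_le rho d z x y :
  comp_cross rho d x y <= cross d x z + cross rho z y.
Proof. by apply: inf_lbound; [case: (comp_has_inf rho d x y)|exists z]. Qed.

Lemma le_comp rho d x y a :
  (forall z, a <= cross d x z + cross rho z y) -> a <= comp_cross rho d x y.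
Proof.
move=> h; apply: lb_le_inf; first by case: (comp_has_inf rho d x y).
by move=> _ [z _ <-].
Qed.

Lemma comp_approx rho d x y M : comp_cross rho d x y <= M ->
  exists z, cross d x z + cross rho z y <= M + 1.
Proof.
move=> cM; have [_ [z _ <-] zM] := inf_adherent ltr01 (comp_has_inf rho d x y).
by exists z; rewrite (le_trans (ltW zM))// lerD2r.
Qed.

Section Comp.
Variables rho d : dbl_metric.

Let comp_gap : exists2 e, 0 < e & forall x y, e <= comp_cross rho d x y.
Proof.
have [e e0 ed] := cross_gap d; exists e => // x y; apply: le_comp => z.
by rewrite -[leLHS]addr0 lerD ?cross_ge0.
Qed.

Let comp_l z x y : comp_cross rho d x y <= dX x z + comp_cross rho d z y.
Proof.
rewrite -lerBlDl; apply: le_comp => u; rewrite lerBlDl.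
have := comp_le rho d u x y; have := cross_l d z x u; lra.
Qed.

Let comp_r z x y : comp_cross rho d x y <= comp_cross rho d x z + dX z y.
Proof.
rewrite -lerBlDr; apply: le_comp => u; rewrite lerBlDr.
have := comp_le rho d u x y; have := cross_r rho z u y; lra.
Qed.

Let dist_compl y x z : dX x z <= comp_cross rho d x y + comp_cross rho d z y.
Proof.
rewrite -lerBlDr; apply: le_comp => u; rewrite lerBlDr -lerBlDl.
apply: le_comp => v; rewrite lerBlDl.
have := metric_triangle x z z; have := dist_crossl rho y u v.
have := dist_crossl d v x z; have := cross_r d u x v.
have := cross_r d v x u; rewrite (metric_sym v u).
have := cross_ge0 d x u; lra.
Qed.

Let dist_compr y x z : dX x z <= comp_cross rho d y x + comp_cross rho d y z.
Proof.
rewrite -lerBlDr; apply: le_comp => u; rewrite lerBlDr -lerBlDl.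
apply: le_comp => v; rewrite lerBlDl.
have := dist_crossr d y u v; have := dist_crossr rho v x z.
have := cross_l rho v u x; have := cross_l rho u v x; rewrite (metric_sym v u).
lra.
Qed.

(* The product $\rho d$.                                                      *)
Definition dbl_comp : dbl_metric :=
  dbl_of_cross comp_gap comp_l comp_r dist_compl dist_compr.

End Comp.

Lemma dbl_compE rho d x y : cross (dbl_comp rho d) x y = comp_cross rho d x y.
Proof. by []. Qed.

Definition dbl_ctrl (d1 d2 : dbl_metric) : Prop :=
  coarse_ctrl (fun p : X * X => cross d1 p.1 p.2)
              (fun p : X * X => cross d2 p.1 p.2).

Lemma coarse_equivP d1 d2 :
  coarse_equiv d1 d2 <-> dbl_ctrl d1 d2 /\ dbl_ctrl d2 d1.
Proof. by apply: coarse_eqP => t; exact: cross_ge0. Qed.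

Lemma dbl_ctrl_comp rho1 rho2 d1 d2 : dbl_ctrl rho1 rho2 -> dbl_ctrl d1 d2 ->
  dbl_ctrl (dbl_comp rho1 d1) (dbl_comp rho2 d2).
Proof.
move=> rho12 d12 M; have [N1 rhoN1] := rho12 (M + 1).
have [N2 dN2] := d12 (M + 1); exists (N2 + N1) => -[x y] /= /comp_approx[z zM].
apply: le_trans (comp_le _ _ z _ _) _; apply: lerD.
- by apply: (dN2 (x, z)) => /=; have := cross_ge0 rho1 z y; lra.
- by apply: (rhoN1 (z, y)) => /=; have := cross_ge0 d1 x z; lra.
Qed.

Definition coarse_rel (d1 d2 : dbl_metric) : bool := `[< coarse_equiv d1 d2 >].

Lemma coarse_rel_class : equiv_class_of coarse_rel.
Proof.
split=> [d|d1 d2|d2 d1 d3].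
- by apply/asboolP/coarse_equivP; split; exact: coarse_ctrl_refl.
- by apply/asboolP/asboolP => /coarse_equivP[? ?]; apply/coarse_equivP.
- move=> /asboolP/coarse_equivP[d12 d21] /asboolP/coarse_equivP[d23 d32].
  apply/asboolP/coarse_equivP; split.
    exact: coarse_ctrl_trans d12 d23.
  exact: coarse_ctrl_trans d32 d21.
Qed.

Canonical coarse_rel_equiv := EquivRelPack coarse_rel_class.
Canonical coarse_rel_encModRel := defaultEncModRel coarse_rel.

Definition Mc := {eq_quot coarse_rel}.
HB.instance Definition _ : EqQuotient dbl_metric coarse_rel Mc :=
  EqQuotient.on Mc.
HB.instance Definition _ := Choice.on Mc.

Definition coarse_class (d : dbl_metric) : Mc := \pi_Mc d.

Lemma coarse_classP d1 d2 :
  coarse_class d1 = coarse_class d2 <-> dbl_ctrl d1 d2 /\ dbl_ctrl d2 d1.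
Proof.
rewrite -coarse_equivP; split=> [/eqmodP/asboolP//|h].
by apply/eqmodP/asboolP.
Qed.

Definition Mc_mul : Mc -> Mc -> Mc := lift_op2 Mc dbl_comp.

Lemma Mc_mulE rho d :
  Mc_mul (coarse_class rho) (coarse_class d) = coarse_class (dbl_comp rho d).
Proof.
rewrite /Mc_mul; unlock.
have /coarse_classP[h1 h2] : coarse_class (repr (coarse_class rho)) = coarse_class rho.
  exact: reprK.
have /coarse_classP[h3 h4] : coarse_class (repr (coarse_class d)) = coarse_class d.
  exact: reprK.
by apply/coarse_classP; split; exact: dbl_ctrl_comp.
Qed.

(* The set E(M^c(X)) of idempotents.                                          *)
Record idem := Idem { idem_val : Mc; idem_valP : Mc_mul idem_val idem_val == idem_val }.

HB.instance Definition _ := [isSub for idem_val].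
HB.instance Definition _ := [Choice of idem by <:].


(* The functions $x\mapsto d(x,x')$ are exactly the following ones, and an    *)
(* idempotent is determined by the coarse equivalence class of its function.  *)
Record diag_fun := DiagFun {
  df :> X -> R;
  df_lip : forall x y, df x <= df y + dX x y *+ 2;
  df_gap : exists2 e, 0 < e & forall x, e <= df x }.

Lemma df_ge0 (f : diag_fun) x : 0 <= f x.
Proof. by have [e /ltW e0 ef] := df_gap f; exact: le_trans (ef x). Qed.

Lemma diag_lip d x y : diag d x <= diag d y + dX x y *+ 2.
Proof.
have := cross_l d y x x; have := cross_r d y y x; rewrite (metric_sym y x).
rewrite /diag; lra.
Qed.

Lemma diag_gap d : exists2 e, 0 < e & forall x, e <= diag d x.
Proof. by have [e e0 ed] := cross_gap d; exists e => // x; exact: ed. Qed.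

Definition diag_of (d : dbl_metric) : diag_fun :=
  DiagFun (diag_lip d) (diag_gap d).

Section DblOfDiag.
Variable f : diag_fun.

Let c x y := Num.max (dX x y) ((f x + f y) / 2).

Let c_ge x y : dX x y <= c x y /\ (f x + f y) / 2 <= c x y.
Proof. by rewrite /c !le_max !lexx orbT. Qed.

Let c_gap : exists2 e, 0 < e & forall x y, e <= c x y.
Proof.
have [e e0 ef] := df_gap f; exists e => // x y.
by have [_] := c_ge x y; have := ef x; have := ef y; lra.
Qed.

Let c_l z x y : c x y <= dX x z + c z y.
Proof.
have [h1 h2] := c_ge z y; rewrite {1}/c ge_max; apply/andP; split.
  by have := metric_triangle x z y; lra.
by have := df_lip f x z; lra.
Qed.

Let c_r z x y : c x y <= c x z + dX z y.
Proof.
have [h1 h2] := c_ge x z; rewrite {1}/c ge_max; apply/andP; split.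
  by have := metric_triangle x z y; lra.
by have := df_lip f y z; rewrite (metric_sym y z); lra.
Qed.

Let dist_cl y x z : dX x z <= c x y + c z y.
Proof.
have [h1 _] := c_ge x y; have [h2 _] := c_ge z y.
by have := metric_triangle x y z; rewrite (metric_sym y z); lra.
Qed.

Let dist_cr y x z : dX x z <= c y x + c y z.
Proof.
have [h1 _] := c_ge y x; have [h2 _] := c_ge y z.
by have := metric_triangle x y z; rewrite (metric_sym x y); lra.
Qed.

(* A selfadjoint metric with $d(x,x')=f(x)$, see [diag_dbl_of_diag].          *)
Definition dbl_of_diag : dbl_metric :=
  dbl_of_cross c_gap c_l c_r dist_cl dist_cr.

Lemma cross_dbl_of_diag x y :
  cross dbl_of_diag x y = Num.max (dX x y) ((f x + f y) / 2).
Proof. by []. Qed.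

Lemma selfadjoint_dbl_of_diag : selfadjoint dbl_of_diag.
Proof. by move=> x y; rewrite !cross_dbl_of_diag metric_sym [f x + _]addrC. Qed.

Lemma diag_dbl_of_diag : diag dbl_of_diag =1 f.
Proof.
move=> x; rewrite /diag cross_dbl_of_diag mdistxx max_r; first by lra.
by have := df_ge0 f x; lra.
Qed.

Lemma dbl_of_diag_le x y M : cross dbl_of_diag x y <= M ->
  [/\ dX x y <= M, f x <= M *+ 2 & f y <= M *+ 2].
Proof.
rewrite cross_dbl_of_diag ge_max => /andP[h1 h2].
by have := df_ge0 f x; have := df_ge0 f y; split => //; lra.
Qed.

Lemma le_dbl_of_diag x y : cross dbl_of_diag x y <= f x + dX x y.
Proof. by rewrite -diag_dbl_of_diag; exact: cross_r. Qed.

End DblOfDiag.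

Lemma dbl_ctrl_diag d1 d2 :
  dbl_ctrl d1 d2 -> coarse_ctrl (diag d1) (diag d2).
Proof. by move=> d12 M; have [N h] := d12 M; exists N => x /(h (x, x)). Qed.

Lemma cross_le_diag d x y : cross d x y <= diag d x + dX x y.
Proof. exact: cross_r. Qed.

(* A class is idempotent iff $d(x,x')$ is controlled by $d(x,y')$.            *)
Lemma idemP d :
  Mc_mul (coarse_class d) (coarse_class d) = coarse_class d <->
  forall M, exists N, forall x y, cross d x y <= M -> diag d x <= N.
Proof.
rewrite Mc_mulE coarse_classP; split=> [[_ h] M|h].
  have [N hN] := h M; exists (M + (N + 1) *+ 2) => x y xyM.
  have /comp_approx[z zN] := hN (x, y) xyM.
  have := cross_r d z x x; have := dist_crossl d y x z.
  rewrite (metric_sym z x) -/(diag d x) => h1 h2.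
  by have := cross_ge0 d x z; have := cross_ge0 d z y; move: xyM => /=; lra.
split=> M.
  have [N hN] := h (M + 1); exists (M + 1 + N + N + N) => -[x y] /= /comp_approx[z zM].
  have xz0 := cross_ge0 d x z; have zy0 := cross_ge0 d z y.
  have dx : diag d x <= N by apply: (hN x z); lra.
  have dz : diag d z <= N by apply: (hN z y); lra.
  have := dist_crossr d x x z; rewrite -/(diag d x) => xz.
  have := cross_l d z x y; have := cross_ge0 d x x; rewrite -/(diag d x).
  have := cross_ge0 d z z; rewrite -/(diag d z); lra.
have [N hN] := h M; exists (N + M) => -[x y] /= xyM.
apply: le_trans (comp_le d d x x y) _.
by have := hN x y xyM; rewrite /diag; lra.
Qed.

Lemma coarse_class_diag d :
  Mc_mul (coarse_class d) (coarse_class d) = coarse_class d ->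
  coarse_class d = coarse_class (dbl_of_diag (diag_of d)).
Proof.
move=> /idemP h; apply/coarse_classP; split=> M.
  have [N hN] := h M; exists (N + (M + N)) => -[x y] /= xyM.
  have dx := hN x y xyM.
  have := le_dbl_of_diag (diag_of d) x y; have := dist_crossr d x x y.
  rewrite -/(diag d x) /=; lra.
exists (M *+ 3) => -[x y] /= /dbl_of_diag_le[h1 h2 _].
by have := cross_le_diag d x y; move: h2 => /=; lra.
Qed.

Lemma idem_dbl_of_diag (f : diag_fun) :
  Mc_mul (coarse_class (dbl_of_diag f)) (coarse_class (dbl_of_diag f)) ==
  coarse_class (dbl_of_diag f).
Proof.
apply/eqP/idemP => M; exists (M *+ 2) => x y /dbl_of_diag_le[_ + _].
by rewrite diag_dbl_of_diag.
Qed.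

Definition idem_of_diag (f : diag_fun) : idem := Idem (idem_dbl_of_diag f).

Definition class_idem (d : dbl_metric)
    (h : forall M, exists N, forall x y, cross d x y <= M -> diag d x <= N) :
  idem := Idem (introT eqP ((idemP d).2 h)).

(* A selfadjoint representative of an idempotent class.                       *)
Definition sarep (p : idem) : dbl_metric :=
  dbl_of_diag (diag_of (repr (\val p))).

Lemma sarepP (p : idem) : selfadjoint (sarep p) /\ coarse_class (sarep p) = \val p.
Proof.
split; first exact: selfadjoint_dbl_of_diag.
have E : coarse_class (repr (\val p)) = \val p by exact: reprK.
rewrite /sarep -coarse_class_diag ?E//; exact/eqP/idem_valP.
Qed.

Definition idem_fun (p : idem) : diag_fun := diag_of (sarep p).

Lemma idem_of_diag_eq (f g : diag_fun) :
  coarse_ctrl f g -> coarse_ctrl g f -> idem_of_diag f = idem_of_diag g.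
Proof.
suff H (f1 f2 : diag_fun) : coarse_ctrl f1 f2 ->
    dbl_ctrl (dbl_of_diag f1) (dbl_of_diag f2).
  by move=> fg gf; apply: val_inj; apply/coarse_classP; split; exact: H.
move=> h M; have [N hN] := h (M *+ 2).
exists (N + M) => -[x y] /= /dbl_of_diag_le[xy /hN fx _].
by have := le_dbl_of_diag f2 x y; lra.
Qed.

Lemma eq_idem_of_diag (f g : diag_fun) :
  f =1 g -> idem_of_diag f = idem_of_diag g.
Proof.
by move=> fg; apply: idem_of_diag_eq => M; exists M => x; rewrite fg.
Qed.

Lemma idem_funK p : idem_of_diag (idem_fun p) = p.
Proof.
apply: val_inj => /=; have [_ <-] := sarepP p; rewrite -coarse_class_diag//.
by have [_ ->] := sarepP p; exact/eqP/idem_valP.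
Qed.

Lemma idem_of_diagK (f : diag_fun) :
  coarse_ctrl (idem_fun (idem_of_diag f)) f /\
  coarse_ctrl f (idem_fun (idem_of_diag f)).
Proof.
have /coarse_classP[] := (sarepP (idem_of_diag f)).2.
have E M x : (f x <= M) = (diag (dbl_of_diag f) x <= M) by rewrite diag_dbl_of_diag.
by move=> /dbl_ctrl_diag h1 /dbl_ctrl_diag h2; split=> M;
  [have [N hN] := h1 M|have [N hN] := h2 M]; exists N => x; rewrite E => /hN.
Qed.

Lemma max_lip (f g : diag_fun) x y :
  Num.max (f x) (g x) <= Num.max (f y) (g y) + dX x y *+ 2.
Proof.
have hf := df_lip f x y; have hg := df_lip g x y.
have : f y <= Num.max (f y) (g y) by rewrite le_max lexx.
have : g y <= Num.max (f y) (g y) by rewrite le_max lexx orbT.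
by rewrite ge_max => ? ?; apply/andP; split; lra.
Qed.

Lemma max_gap (f g : diag_fun) :
  exists2 e, 0 < e & forall x, e <= Num.max (f x) (g x).
Proof.
by have [e e0 ef] := df_gap f; exists e => // x; rewrite le_max ef.
Qed.

Definition max_diag (f g : diag_fun) : diag_fun :=
  DiagFun (max_lip f g) (max_gap f g).

Lemma min_lip (f g : diag_fun) x y :
  Num.min (f x) (g x) <= Num.min (f y) (g y) + dX x y *+ 2.
Proof.
have hf := df_lip f x y; have hg := df_lip g x y.
rewrite -lerBlDr le_min !lerBlDr; apply/andP.
have : Num.min (f x) (g x) <= f x by rewrite ge_min lexx.
have : Num.min (f x) (g x) <= g x by rewrite ge_min lexx orbT.
by split; lra.
Qed.

Lemma min_gap (f g : diag_fun) :
  exists2 e, 0 < e & forall x, e <= Num.min (f x) (g x).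
Proof.
have [e e0 ef] := df_gap f; have [e' e'0 eg] := df_gap g.
exists (Num.min e e') => [|x]; first by rewrite lt_min e0.
by rewrite le_min !ge_min ef eg orbT.
Qed.

Definition min_diag (f g : diag_fun) : diag_fun :=
  DiagFun (min_lip f g) (min_gap f g).

Lemma mul_dbl_of_diag (f g : diag_fun) :
  Mc_mul (coarse_class (dbl_of_diag f)) (coarse_class (dbl_of_diag g)) =
  coarse_class (dbl_of_diag (max_diag f g)).
Proof.
rewrite Mc_mulE; apply/coarse_classP; split=> M.
  exists (M *+ 10 + 10) => -[x y] /= /comp_approx[z zM].
  have xz0 := cross_ge0 (dbl_of_diag g) x z.
  have zy0 := cross_ge0 (dbl_of_diag f) z y.
  have /dbl_of_diag_le[xz gx _] : cross (dbl_of_diag g) x z <= M + 1 by lra.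
  have /dbl_of_diag_le[zy fz _] : cross (dbl_of_diag f) z y <= M + 1 by lra.
  have fxz := df_lip f x z; have xyz := metric_triangle x z y.
  apply: le_trans (le_dbl_of_diag _ x y) _.
  by rewrite -lerBrDr /= ge_max; apply/andP; split; lra.
exists (M *+ 10) => -[x y] /= /dbl_of_diag_le[xyM + _].
rewrite /= ge_max => /andP[fx gx].
apply: le_trans (comp_le _ _ x x y) _.
have := le_dbl_of_diag f x y; have := le_dbl_of_diag g x x.
by rewrite mdistxx; have := df_ge0 f x; lra.
Qed.

Lemma idem_meet_idem (p q : idem) :
  Mc_mul (Mc_mul (\val p) (\val q)) (Mc_mul (\val p) (\val q)) ==
  Mc_mul (\val p) (\val q).
Proof.
rewrite -(idem_funK p) -(idem_funK q) /= mul_dbl_of_diag.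
exact: idem_dbl_of_diag.
Qed.

(* $p\wedge q=pq$ and $p\vee q$ is the idempotent given by the minimum of the *)
(* functions $d(x,x')$ of selfadjoint representatives of $p$ and $q$.         *)
Definition idem_meet (p q : idem) : idem := Idem (idem_meet_idem p q).
Definition idem_join (p q : idem) : idem :=
  idem_of_diag (min_diag (idem_fun p) (idem_fun q)).

Lemma idem_meetE f g :
  idem_meet (idem_of_diag f) (idem_of_diag g) = idem_of_diag (max_diag f g).
Proof. by apply: val_inj => /=; exact: mul_dbl_of_diag. Qed.

Lemma idem_joinE f g :
  idem_join (idem_of_diag f) (idem_of_diag g) = idem_of_diag (min_diag f g).
Proof.
have [f1 f2] := idem_of_diagK f; have [g1 g2] := idem_of_diagK g.
apply: idem_of_diag_eq => M; [have [N hN] := f1 M; have [N' hN'] := g1 M|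
  have [N hN] := f2 M; have [N' hN'] := g2 M];
  exists (Num.max N N') => x; rewrite /= !ge_min !le_max;
  by move=> /orP[/hN ->|/hN' ->]; rewrite ?orbT.
Qed.

Lemma idem_ind (P : idem -> Prop) :
  (forall f, P (idem_of_diag f)) -> forall p, P p.
Proof. by move=> h p; rewrite -(idem_funK p). Qed.

Lemma idem_meetC : commutative idem_meet.
Proof.
elim/idem_ind => f; elim/idem_ind => g; rewrite !idem_meetE.
by apply: eq_idem_of_diag => x /=; rewrite maxC.
Qed.

Lemma idem_joinC : commutative idem_join.
Proof.
elim/idem_ind => f; elim/idem_ind => g; rewrite !idem_joinE.
by apply: eq_idem_of_diag => x /=; rewrite minC.
Qed.

Lemma idem_meetA : associative idem_meet.
Proof.
elim/idem_ind => f; elim/idem_ind => g; elim/idem_ind => h.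
by rewrite !idem_meetE; apply: eq_idem_of_diag => x /=; rewrite maxA.
Qed.

Lemma idem_joinA : associative idem_join.
Proof.
elim/idem_ind => f; elim/idem_ind => g; elim/idem_ind => h.
by rewrite !idem_joinE; apply: eq_idem_of_diag => x /=; rewrite minA.
Qed.

Lemma idem_joinKI q p : idem_meet p (idem_join p q) = p.
Proof.
elim/idem_ind: p => f; elim/idem_ind: q => g; rewrite idem_joinE idem_meetE.
by apply: eq_idem_of_diag => x /=; rewrite maxC minC minxK.
Qed.

Lemma idem_meetKU q p : idem_join p (idem_meet p q) = p.
Proof.
elim/idem_ind: p => f; elim/idem_ind: q => g; rewrite idem_meetE idem_joinE.
by apply: eq_idem_of_diag => x /=; rewrite maxKx.
Qed.

Lemma idem_meetUl : left_distributive idem_meet idem_join.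
Proof.
elim/idem_ind => f; elim/idem_ind => g; elim/idem_ind => h.
rewrite !(idem_joinE, idem_meetE); apply: eq_idem_of_diag => x /=.
by rewrite max_minl.
Qed.

Lemma idem_meetxx : idempotent_op idem_meet.
Proof.
elim/idem_ind => f; rewrite idem_meetE.
by apply: eq_idem_of_diag => x /=; rewrite maxxx.
Qed.

Fact idem_display : Order.disp_t. Proof. exact: Order.Disp tt tt. Qed.

HB.instance Definition _ := @Order.isMeetJoinDistrLattice.Build idem_display idem
  _ _ idem_meet idem_join (fun _ _ => erefl) (fun _ _ => erefl)
  idem_meetC idem_joinC idem_meetA idem_joinA idem_joinKI idem_meetKU
  idem_meetUl idem_meetxx.

(* The metrics $d_X(x,y)+1$ and $d_X(x,x_0)+1+d_X(x_0,y)$.                    *)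
Lemma top_gap : exists2 e, 0 < e & forall x y, e <= dX x y + 1.
Proof. by exists 1 => // x y; rewrite lerDr mdist_ge0. Qed.

Lemma top_l z x y : dX x y + 1 <= dX x z + (dX z y + 1).
Proof. by rewrite addrA lerD2r metric_triangle. Qed.

Lemma top_r z x y : dX x y + 1 <= dX x z + 1 + dX z y.
Proof. by rewrite addrAC lerD2r metric_triangle. Qed.

Lemma dist_topl y x z : dX x z <= dX x y + 1 + (dX z y + 1).
Proof. by have := metric_triangle x y z; rewrite (metric_sym y z); lra. Qed.

Lemma dist_topr y x z : dX x z <= dX y x + 1 + (dX y z + 1).
Proof. by have := metric_triangle x y z; rewrite (metric_sym x y); lra. Qed.

Definition dbl_top : dbl_metric :=
  dbl_of_cross top_gap top_l top_r dist_topl dist_topr.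

Lemma dbl_top_idem M : exists N, forall x y,
  cross dbl_top x y <= M -> diag dbl_top x <= N.
Proof. by exists 1 => x y _; rewrite /diag dbl_of_crossE mdistxx add0r. Qed.

Definition idem_top : idem := class_idem dbl_top_idem.

Lemma idem_lex1 (p : idem) : (p <= idem_top)%O.
Proof.
have -> : (p <= idem_top)%O = (idem_meet p idem_top == p) by [].
rewrite -(idem_funK p) -(idem_funK idem_top) idem_meetE; apply/eqP.
have /coarse_classP[/dbl_ctrl_diag h _] : coarse_class dbl_top = coarse_class (sarep idem_top).
  by have [_ ->] := sarepP idem_top.
have [N hN] := h 1; apply: idem_of_diag_eq => M; first by exists M => x; rewrite ge_max => /andP[].
exists (Num.max M N) => x fM; rewrite ge_max !le_max fM /= hN ?orbT//.
by rewrite /diag dbl_of_crossE mdistxx add0r.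
Qed.

HB.instance Definition _ := Order.hasTop.Build idem_display idem idem_lex1.

Section Bottom.
Variable x0 : X.

Let c x y := dX x x0 + 1 + dX x0 y.

Let bot_gap : exists2 e, 0 < e & forall x y, e <= c x y.
Proof.
exists 1 => // x y; rewrite /c; have := mdist_ge0 x x0.
by have := mdist_ge0 x0 y; lra.
Qed.

Let bot_l z x y : c x y <= dX x z + c z y.
Proof. by rewrite /c; have := metric_triangle x z x0; lra. Qed.

Let bot_r z x y : c x y <= c x z + dX z y.
Proof. by rewrite /c; have := metric_triangle x0 z y; lra. Qed.

Let dist_botl y x z : dX x z <= c x y + c z y.
Proof.
rewrite /c; have := metric_triangle x x0 z; rewrite (metric_sym x0 z).
by have := mdist_ge0 x0 y; lra.
Qed.

Let dist_botr y x z : dX x z <= c y x + c y z.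
Proof.
rewrite /c; have := metric_triangle x x0 z; rewrite (metric_sym x x0).
by have := mdist_ge0 y x0; lra.
Qed.

Definition dbl_bot : dbl_metric :=
  dbl_of_cross bot_gap bot_l bot_r dist_botl dist_botr.

Lemma dbl_bot_idem M : exists N, forall x y,
  cross dbl_bot x y <= M -> diag dbl_bot x <= N.
Proof.
exists (M *+ 2) => x y; rewrite /diag !dbl_of_crossE /c (metric_sym x0 x).
by have := mdist_ge0 x0 y; have := mdist_ge0 x x0; lra.
Qed.

Definition idem_bot : idem := class_idem dbl_bot_idem.

End Bottom.

Lemma idem_unitm (p q : idem) : (p `&` q = \top -> p = \top /\ q = \top)%O.
Proof.
move=> pq; split; apply/eqP; rewrite -le1x -pq; first exact: leIl.
exact: leIr.
Qed.

(* The multiplication of the monoid algebra is $\wedge$ extended linearly.    *)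
HB.instance Definition _ := Choice_isMonomialDef.Build idem
  (@meetA _ idem) (@meet1x _ idem) (@meetx1 _ idem) idem_unitm.
HB.instance Definition _ := MonomialDef_isConomialDef.Build idem (@meetC _ idem).

(* Finite formal sums mod 2 of idempotents: [bool] is the field with two      *)
(* elements, its addition being [addb] and its multiplication [andb].         *)
Definition formal_sums : comNzRingType := {malg bool[idem]}.

Definition formal (e : idem) : formal_sums := << e >>.

(* Besides the relations $e+f+e\wedge f+e\vee f$, the generators contain the  *)
(* minimal idempotent, which makes it equal to the empty sum, as it should    *)
(* when the formal sums are restricted to nonzero idempotents.                *)
Definition relators : set formal_sums :=
  [set formal (idem_bot x0) | x0 in [set: X]] `|`
  [set formal p.1 + formal p.2 + formal (p.1 `&` p.2)%O + formal (p.1 `|` p.2)%O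
     | p in [set: idem * idem]].

Definition relations : {pred formal_sums} := ideal_pred relators.

HB.instance Definition _ := GRing.isZmodClosed.Build formal_sums relations
  (ideal_pred_zmod relators).

(* The Boolean algebra L^c(X), as a Boolean ring, i.e., $\wedge$ is the       *)
(* multiplication and the symmetric difference is the addition. It is not an  *)
(* [ideal_quot] because it is trivial when [X] is bounded.                    *)
Definition Lc := Quotient.quot (relations : zmodClosed formal_sums).
HB.instance Definition _ := GRing.Zmodule.on Lc.
HB.instance Definition _ := Quotient.on Lc.

Definition Lc_class (a : formal_sums) : Lc := \pi_Lc a.

Lemma Lc_classD : {morph Lc_class : a b / a + b}.
Proof. exact: Quotient.pi_add. Qed.

Lemma Lc_classP a b : Lc_class a = Lc_class b <-> a - b \in relations.
Proof.
rewrite Quotient.idealrBE; split=> [h|/eqP//].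
by apply/eqP.
Qed.

Definition Lc_one : Lc := Lc_class 1.
Definition Lc_mul : Lc -> Lc -> Lc := lift_op2 Lc *%R.

Lemma Lc_mulE a b : Lc_mul (Lc_class a) (Lc_class b) = Lc_class (a * b).
Proof.
rewrite /Lc_mul; unlock.
set a' := repr _; set b' := repr _.
have aa' : a' - a \in relations by apply/Lc_classP; exact: reprK.
have bb' : b' - b \in relations by apply/Lc_classP; exact: reprK.
apply/Lc_classP.
rewrite (_ : _ - _ = b' * (a' - a) + a * (b' - b)); last first.
  by rewrite !mulrBr addrA (mulrC b' a') (mulrC b' a) subrK.
by rewrite rpredD// ideal_pred_mul.
Qed.

Lemma Lc_ind (P : Lc -> Prop) : (forall a, P (Lc_class a)) -> forall x, P x.
Proof. by move=> h x; rewrite -[x]reprK; exact: h. Qed.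

Lemma Lc_mulA : associative Lc_mul.
Proof.
elim/Lc_ind => a; elim/Lc_ind => b; elim/Lc_ind => c.
by rewrite !Lc_mulE mulrA.
Qed.

Lemma Lc_mulC : commutative Lc_mul.
Proof. by elim/Lc_ind => a; elim/Lc_ind => b; rewrite !Lc_mulE mulrC. Qed.

Lemma Lc_mul1 : left_id Lc_one Lc_mul.
Proof. by elim/Lc_ind => a; rewrite Lc_mulE mul1r. Qed.

Lemma Lc_mulDl : left_distributive Lc_mul +%R.
Proof.
elim/Lc_ind => a; elim/Lc_ind => b; elim/Lc_ind => c.
by rewrite -Lc_classD !Lc_mulE mulrDl Lc_classD.
Qed.

HB.instance Definition _ := GRing.Zmodule_isComPzRing.Build Lc
  Lc_mulA Lc_mulC Lc_mul1 Lc_mulDl.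

Definition Lc_of (e : idem) : Lc := Lc_class (formal e).

Lemma formalM e f : formal (e `&` f)%O = formal e * formal f.
Proof.
by apply/esym; rewrite /formal [LHS]fgmulUU mulr1.
Qed.

Lemma Lc_of_top : Lc_of \top%O = 1.
Proof. by []. Qed.

Lemma Lc_of_meet e f : Lc_of (e `&` f)%O = Lc_of e * Lc_of f.
Proof. by rewrite /Lc_of formalM -Lc_mulE. Qed.

Lemma Lc_class_relator r : relators r -> Lc_class r = 0.
Proof.
move=> rr; have : Lc_class 0 = Lc_class 0 + Lc_class 0.
  by rewrite -Lc_classD addr0.
rewrite -[LHS]addr0 => /addrI ->; apply/Lc_classP; rewrite subr0; apply/asboolP.
exists 1%N, (fun=> 1), (fun=> r); split => //.
by rewrite big_ord1 mul1r.
Qed.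

Lemma Lc_of_bot x0 : Lc_of (idem_bot x0) = 0.
Proof. by apply: Lc_class_relator; left; exists x0. Qed.

Lemma Lc_of_join e f :
  Lc_of e + Lc_of f + Lc_of (e `&` f)%O + Lc_of (e `|` f)%O = 0.
Proof.
by rewrite -!Lc_classD; apply: Lc_class_relator; right; exists (e, f).
Qed.

(* The Stone space: Boolean homomorphisms into the two-element Boolean        *)
(* algebra, with the topology of pointwise convergence.                       *)
Definition stone : Type := {rmorphism Lc -> bool}.
HB.instance Definition _ := gen_eqMixin stone.
HB.instance Definition _ := gen_choiceMixin stone.

Definition stone_eval (phi : stone) : {ptws Lc -> bool} :=
  fun a => (phi : {rmorphism Lc -> bool}) a.

HB.instance Definition _ := Topological.copy stone (initial_topology stone_eval).

Definition stone_clopen (a : Lc) : set stone := [set phi | stone_eval phi a = 1].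

Definition clopen_sigma_algebra : set (set stone) :=
  <<s [set A : set stone | clopen A] >>.

Definition metric_bounded (A : set X) : Prop :=
  exists M, forall x y, A x -> A y -> dX x y <= M.

(* Only the values of [mu] at closed sets matter.                             *)
Definition admissible_measure (mu : set X -> R) : Prop :=
  [/\ forall A, closed A -> 0 <= mu A <= 1,
      forall A B, closed A -> closed B -> A `<=` B -> mu A <= mu B,
      mu set0 = 0 /\ mu setT = 1,
      forall A B, closed A -> closed B ->
        mu (A `&` B) + mu (A `|` B) = mu A + mu B &
      forall K, closed K -> metric_bounded K -> mu K = 0].

Section Nu.
Variable mu : set X -> R.

Definition nu_hat (e : idem) : R :=
  lim (mu [set x | diag (sarep e) x <= n%:R] @[n --> \oo]).

Definition nu_sum (n : nat) (e : 'I_n -> idem) : R :=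
  \sum_(1 <= i < n.+1) (- 2) ^+ i.-1 *
    \sum_(J : {set 'I_n} | #|J| == i) nu_hat (\meet_(j in J) e j)%O.

(* Every [a] is a sum $e_1+\dots+e_n$; [nu_sum] does not depend on the chosen *)
(* expression of [a].                                                         *)
Definition nu_bar (a : Lc) : R :=
  xget 0 [set r | exists n (e : 'I_n -> idem),
    a = \sum_i Lc_of (e i) /\ r = nu_sum e].

End Nu.

End Metrics.

Arguments clopen_sigma_algebra {R} X _.

(* [nu] is a (nonnegative) sigma-additive measure on the sigma-algebra [S].   *)
(* The structure of measurable types is not used because it requires a point, *)
(* and that the Stone space has one is not known beforehand.                  *)
Definition sigma_additive_measure (R : realType) (T : Type) (S : set (set T))
    (nu : set T -> \bar R) : Prop :=
  [/\ nu set0 = 0%E, forall A, S A -> (0 <= nu A)%E &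
      forall F : (set T)^nat, (forall n, S (F n)) -> trivIset setT F ->
        (\sum_(0 <= i < n) nu (F i))%E @[n --> \oo] --> nu (\bigcup_n F n)].

(* Main.v *)
Require Import Defs.
From HB Require Import structures.
From mathcomp Require Import all_boot all_order all_algebra.
From mathcomp Require Import finmap.
From mathcomp.multinomials Require Import monalg.
From mathcomp Require Import all_classical all_reals all_analysis.
From mathcomp Require Import ring lra.

Set Implicit Arguments.
Unset Strict Implicit.
Unset Printing Implicit Defensive.

Import Order.TTheory GRing.Theory Num.Theory.
Import numFieldNormedType.Exports.

Local Open Scope classical_set_scope.
Local Open Scope ring_scope.

(** Everything rests on two facts: on the Boolean algebra L^c(X) the function
    nu_bar is a finitely additive probability, and the Stone space is compact.

    For the first, a formal sum of idempotents mod 2 should be thought of as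
    the symmetric difference of sets. Its indicator function is a polynomial in
    the indicators of the summands: if -1 raised to an indicator is called its
    sign, then signs multiply under symmetric difference and the sign of e is
    1 - 2e. This is carried out in the real monoid algebra of the idempotents
    under meet, where a formal sum a is sent to (1 - sign a) / 2, and this map
    turns products into products ([indic_funM]). Expanding the product of the
    1 - 2e_i shows that the defining formula of nu_bar is the linear extension
    of nu_hat applied to this element ([nu_sumE]). Modularity of nu_hat says
    exactly that the linear extension kills the ideal generated by the
    indicators of the relators ([v_relations]), so that nu_bar is well defined
    and additive on disjoint elements. It is nonnegative because the sign has
    integral at most 1 in absolute value ([v_sign_bound]); this is the triangle
    inequality applied after cutting the space into the atoms of the e_i, on
    which nu_hat is nonnegative by monotonicity.

    For the second, the prime ideal theorem for Boolean rings
    ([boolean_separation]) gives at once that a is determined by its clopen set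
    ([stone_clopen_inj]) and that a cover of a basic clopen set by basic clopen
    sets has a finite subcover ([stone_compact]), whence every clopen set is
    basic ([clopen_stoneP]). A countable disjoint union of clopen sets can then
    be clopen only if all but finitely many of them are empty, so finite
    additivity is sigma-additivity on the algebra of clopen sets, and the
    extension theorem of measure theory applies. Uniqueness holds because the
    clopen sets are closed under intersection and the total mass is finite. *)

(** * The valuation on the lattice of idempotents *)

Section NuHat.
Variables (R : realType) (X : metricType R).
Implicit Types (f g : diag_fun X) (e : idem X).

Lemma sublevel_closed f M : closed [set x | f x <= M].
Proof.
move=> x clx /=; apply/ler_addgt0Pl => _/posnumP[e].
have e2 : 0 < e%:num / 2 by [].
have [y [/= fyM]] := clx _ (nbhsx_ballx x _ e2).
rewrite ballEmdist /= => xy; have := df_lip f x y; lra.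
Qed.

Variable mu : set X -> R.
Hypothesis mu_adm : admissible_measure mu.

Definition lim_sublevel f : R := lim (mu [set x | f x <= n%:R] @[n --> \oo]).

Lemma mu_sublevel_le f g M N : (forall x, f x <= M -> g x <= N) ->
  mu [set x | f x <= M] <= mu [set x | g x <= N].
Proof.
by have [_ + _ _ _] := mu_adm; apply => //; exact: sublevel_closed.
Qed.

(** The sequence is nondecreasing and bounded by 1. *)
Lemma cvg_sublevel f : cvgn (fun n => mu [set x | f x <= n%:R]).
Proof.
apply: nondecreasing_is_cvgn.
  move=> m n mn; apply: mu_sublevel_le => x /le_trans; apply.
  by rewrite ler_nat.
exists 1 => _ [n _ <-]; have [mu01 _ _ _ _] := mu_adm.
by have /andP[] := mu01 _ (@sublevel_closed f n%:R).
Qed.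

Lemma mu_sublevel_le_lim f n : mu [set x | f x <= n%:R] <= lim_sublevel f.
Proof.
have nd : nondecreasing_seq (fun n => mu [set x | f x <= n%:R]).
  move=> {}n m nm; apply: mu_sublevel_le => x /le_trans; apply.
  by rewrite ler_nat.
exact: (nondecreasing_cvgn_le nd (@cvg_sublevel f) n).
Qed.

Lemma lim_sublevel_le f g : coarse_ctrl f g -> lim_sublevel f <= lim_sublevel g.
Proof.
move=> fg; apply: limr_le; first exact: cvg_sublevel.
apply: nearW => n; have [N hN] := fg n%:R.
apply: le_trans (mu_sublevel_le_lim g (Num.bound `|N|)).
apply: mu_sublevel_le => x /hN gN; apply: le_trans gN _.
by rewrite ltW// (le_lt_trans (ler_norm N))// archi_boundP.
Qed.

(** Control in both directions makes the two exhaustions of the space by sublevel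
    sets cofinal in each other, so the limit does not see the representative. *)
Lemma nu_hat_of_diag f : nu_hat mu (idem_of_diag f) = lim_sublevel f.
Proof.
have -> : nu_hat mu (idem_of_diag f) = lim_sublevel (idem_fun (idem_of_diag f)).
  by [].
have [h1 h2] := idem_of_diagK f.
apply: le_anti; apply/andP; split; first exact: lim_sublevel_le h1.
exact: lim_sublevel_le h2.
Qed.

(** Sublevel sets turn maxima into intersections and minima into unions, so the
    modularity of mu on closed sets passes to the limit. *)
Lemma nu_hat_modular e e' :
  nu_hat mu (e `&` e')%O + nu_hat mu (e `|` e')%O = nu_hat mu e + nu_hat mu e'.
Proof.
elim/(@idem_ind R X): e => f; elim/(@idem_ind R X): e' => g.
have -> : (idem_of_diag f `&` idem_of_diag g)%O = idem_of_diag (max_diag f g).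
  exact: idem_meetE.
have -> : (idem_of_diag f `|` idem_of_diag g)%O = idem_of_diag (min_diag f g).
  exact: idem_joinE.
rewrite !nu_hat_of_diag /lim_sublevel -!limD; do ?exact: cvg_sublevel.
apply: (congr1 (fun u : R^nat => lim (u @ \oo))); apply/funext => n /=.
have [_ _ _ mod_mu _] := mu_adm.
rewrite !fctE -[RHS]mod_mu; do ?exact: sublevel_closed.
congr (mu _ + mu _); apply/seteqP; split => x /=.
- by rewrite ge_max => /andP.
- by move=> fgx; rewrite ge_max; apply/andP.
- by rewrite ge_min => /orP.
- by rewrite ge_min => /orP.
Qed.

Lemma nu_hat_ge0 e : 0 <= nu_hat mu e.
Proof.
elim/(@idem_ind R X): e => f; rewrite nu_hat_of_diag.
apply: le_trans (mu_sublevel_le_lim f 0).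
have [mu01 _ _ _ _] := mu_adm.
by have /andP[] := mu01 _ (@sublevel_closed f 0).
Qed.

Lemma nu_hat_meet_le e e' : nu_hat mu (e `&` e')%O <= nu_hat mu e.
Proof.
elim/(@idem_ind R X): e => f; elim/(@idem_ind R X): e' => g.
have -> : (idem_of_diag f `&` idem_of_diag g)%O = idem_of_diag (max_diag f g).
  exact: idem_meetE.
rewrite !nu_hat_of_diag; apply: lim_sublevel_le => M; exists M => x /=.
by rewrite ge_max => /andP[].
Qed.

Lemma nu_hat_class (d : dbl_metric X) h :
  nu_hat mu (@class_idem R X d h) = lim_sublevel (diag_of d).
Proof.
rewrite -nu_hat_of_diag; congr (nu_hat _ _); apply: val_inj => /=.
apply: coarse_class_diag; exact/idemP.
Qed.

(** The sublevel sets are balls around x0, on which mu vanishes. *)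
Lemma nu_hat_bot x0 : nu_hat mu (idem_bot x0) = 0.
Proof.
rewrite nu_hat_class /lim_sublevel; apply/cvg_lim => //.
rewrite (_ : (fun n => _) = fun=> 0); first exact: cvg_cst.
apply/funext => n; have [_ _ _ _ ->//] := mu_adm; first exact: sublevel_closed.
exists (n%:R *+ 2) => x y; rewrite /= (metric_sym x0 x) (metric_sym x0 y).
have := metric_triangle x x0 y; rewrite (metric_sym x0 y).
by have := mdist_ge0 x x0; have := mdist_ge0 y x0; lra.
Qed.

Lemma nu_hat_top : nu_hat mu \top%O = 1.
Proof.
have -> : (\top%O : idem X) = idem_top X by [].
rewrite nu_hat_class; apply: le_anti; apply/andP; split.
  apply: limr_le; first exact: cvg_sublevel.
  apply: nearW => n; have [mu01 _ _ _ _] := mu_adm.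
  by have /andP[] := mu01 _ (@sublevel_closed (diag_of (dbl_top X)) n%:R).
apply: le_trans (mu_sublevel_le_lim _ 1).
rewrite (_ : [set _ | _] = setT); first by have [_ _ [_ ->]] := mu_adm.
apply/seteqP; split => // x _ /=.
by rewrite mdistxx add0r.
Qed.

End NuHat.

(** * Indicator functions of formal sums *)

Section Indicators.
Variables (R : realType) (X : metricType R).
Implicit Types (e g : idem X) (a b : formal_sums X).

Lemma formal_sums_ind (P : formal_sums X -> Prop) : P 0 ->
  (forall e a, P a -> P (formal e + a)) -> forall a, P a.
Proof.
move=> P0 PD a; rewrite [a]monalgE; elim: (enum_fset _) => [|k s IHs].
  by rewrite big_nil.
rewrite big_cons; case: (a@_k) => /=; first exact: PD.
by rewrite monalgU0 add0r.
Qed.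

(** A stands for the real monoid algebra of the idempotents under meet, and m for
    its basis; keeping them abstract isolates the few identities that are used. *)
Variables (A : comNzRingType) (half : A) (m : idem X -> A).
Hypothesis half_twice : 2 * half = 1.
Hypothesis mM : forall e g, m (e `&` g)%O = m e * m g.

Let m_idem e : m e * m e = m e.
Proof. by rewrite -mM meetxx. Qed.

Let halfK x : 2 * (half * x) = x.
Proof. by rewrite mulrA half_twice mul1r. Qed.

Let mul2I (x y : A) : 2 * x = 2 * y -> x = y.
Proof. by move=> xy; rewrite -[x]halfK -[y]halfK !(mulrCA 2) xy. Qed.

(** The sign of a symmetric difference is the product of the signs. *)
Definition sign_fun a : A :=
  \prod_(k <- msupp a) (if a@_k then 1 - 2 * m k else 1).

Lemma sign_fun_sub (d : {fset idem X}) a : (msupp a `<=` d)%fset ->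
  sign_fun a = \prod_(k <- d) (if a@_k then 1 - 2 * m k else 1).
Proof.
move=> ad; rewrite /sign_fun (big_fset_incl _ ad)// => k _ /mcoeff_outdom ->.
by [].
Qed.

Lemma sign_mon_sq e : (1 - 2 * m e) * (1 - 2 * m e) = 1.
Proof.
have -> : (1 - 2 * m e) * (1 - 2 * m e) =
  1 - 4 * m e + 4 * (m e * m e) by ring.
by rewrite m_idem subrK.
Qed.

Lemma sign_fun0 : sign_fun 0 = 1.
Proof. by rewrite /sign_fun msupp0 big_nil. Qed.

(** A summand common to both formal sums cancels mod 2, and so does the square
    of its sign. *)
Lemma sign_funD a b : sign_fun (a + b) = sign_fun a * sign_fun b.
Proof.
pose d := (msupp a `|` msupp b)%fset.
rewrite (@sign_fun_sub d) ?msuppD_le// (@sign_fun_sub d a) ?fsubsetUl//.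
rewrite (@sign_fun_sub d b) ?fsubsetUr// -big_split; apply: eq_bigr => k _.
rewrite mcoeffD; case: (a@_k); case: (b@_k); rewrite /= ?mul1r ?mulr1//.
by rewrite sign_mon_sq.
Qed.

Lemma sign_fun_formal e : sign_fun (formal e) = 1 - 2 * m e.
Proof. by rewrite /sign_fun msuppU big_seq_fset1 mcoeffUU. Qed.

(** The indicator function of the symmetric difference of the summands of a. *)
Definition indic_fun a : A := half * (1 - sign_fun a).

Lemma sign_funE a : sign_fun a = 1 - 2 * indic_fun a.
Proof. by rewrite halfK subKr. Qed.

Lemma indic_fun0 : indic_fun 0 = 0.
Proof. by rewrite /indic_fun sign_fun0 subrr mulr0. Qed.

Lemma indic_fun_formal e : indic_fun (formal e) = m e.
Proof. by apply: mul2I; rewrite halfK sign_fun_formal subKr. Qed.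

Lemma indic_funD a b :
  indic_fun (a + b) = indic_fun a + indic_fun b - 2 * indic_fun a * indic_fun b.
Proof. by apply: mul2I; rewrite halfK sign_funD !sign_funE; ring. Qed.

Lemma indic_fun_idem a : indic_fun a * indic_fun a = indic_fun a.
Proof.
have aa : a + a = 0.
  by apply/malgP => k; rewrite mcoeffD mcoeff0; case: (a@_k).
have := indic_funD a a; rewrite aa indic_fun0 => h.
apply: mul2I; apply: (@addrI _ (- (2 * indic_fun a * indic_fun a))).
rewrite mulrA addNr h; ring.
Qed.

Let xorM (x y z : A) : z * z = z ->
  x * z + y * z - 2 * (x * z) * (y * z) = (x + y - 2 * x * y) * z.
Proof.
move=> zz; rewrite (_ : 2 * _ * _ = 2 * x * y * (z * z)); last by ring.
by rewrite zz; ring.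
Qed.

Lemma indic_funD_eq a b x y : indic_fun a = x -> indic_fun b = y ->
  indic_fun (a + b) = x + y - 2 * x * y.
Proof. by move=> <- <-; exact: indic_funD. Qed.

(** Both sides are biadditive for the symmetric difference, so it suffices to
    compare them on idempotents, where the product is the meet. *)
Lemma indic_funM a b : indic_fun (a * b) = indic_fun a * indic_fun b.
Proof.
elim/formal_sums_ind: a => [|e a IHa].
  by rewrite [0 * b]mul0r indic_fun0 mul0r.
suff eb : indic_fun (formal e * b) = m e * indic_fun b.
  have -> : (formal e + a) * b = formal e * b + a * b by exact: mulrDl.
  apply: etrans (indic_funD_eq eb IHa) _.
  rewrite (indic_funD_eq (indic_fun_formal e) (erefl (indic_fun a))).
  by apply: xorM; exact: indic_fun_idem.
elim/formal_sums_ind: b {IHa} => [|g b IHb].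
  by rewrite [_ * 0]mulr0 indic_fun0 mulr0.
have -> : formal e * (formal g + b) = formal (e `&` g)%O + formal e * b.
  by rewrite formalM; exact: mulrDr.
apply: etrans (indic_funD_eq (indic_fun_formal _) IHb) _.
rewrite (indic_funD_eq (indic_fun_formal g) (erefl (indic_fun b))).
by rewrite mM [m e * m g]mulrC ![m e * _]mulrC; apply: xorM; exact: m_idem.
Qed.

End Indicators.

(** * The real monoid algebra *)

Section MonoidAlgebra.
Variables (K : choiceType) (S : comNzRingType).

Lemma monalgU_scale (c : S) (k : K) : << c *g k >> = c *: << k >>.
Proof. by apply/malgP => k'; rewrite mcoeffZ !mcoeffU mulrnAr mulr1. Qed.

Lemma mmap_scale (h : K -> S) (c : S) (y : {malg S[K]}) :
  mmap idfun h (c *: y) = c * mmap idfun h y.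
Proof.
rewrite (mmapEw (msuppZ_le _ _)) mmapE mulr_sumr.
by apply: eq_bigr => k _; rewrite mcoeffZ mulrA.
Qed.

End MonoidAlgebra.


(** * The linear extension of the valuation and nu_bar *)

Section Valuation.
Variables (R : realType) (X : metricType R) (mu : set X -> R).
Hypothesis mu_adm : admissible_measure mu.
Implicit Types (e f g : idem X) (a b : formal_sums X).
Variables (A : comNzRingType) (half : A) (m : idem X -> A).
Hypothesis half_twice : 2 * half = 1.
Hypothesis mM : forall e g, m (e `&` g)%O = m e * m g.
Hypothesis m1 : m \top%O = 1.
Variable v : {additive A -> R}.
Hypothesis v_m : forall e, v (m e) = nu_hat mu e.
(* Holds in the monoid algebra because the elements m g span it linearly. *)
Hypothesis v_span : forall y, (forall g, v (m g * y) = 0) ->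
  forall x, v (x * y) = 0.

Local Notation indic := (indic_fun half m).
Local Notation sgn := (sign_fun m).

Let m_idem e : m e * m e = m e.
Proof. by rewrite -mM meetxx. Qed.

Let indic_formal e : indic (formal e) = m e.
Proof. exact: indic_fun_formal. Qed.

(** Under the absorption laws the indicator of the relator becomes the
    inclusion-exclusion defect of the join. *)
Lemma indic_fun_join_relator p q :
  indic (formal p + formal q + formal (p `&` q)%O + formal (p `|` q)%O) =
  m (p `|` q)%O - m p - m q + m (p `&` q)%O.
Proof.
have indicDE := indic_funD_eq half_twice mM.
have pu : m p * m (p `|` q)%O = m p by rewrite -mM joinKI.
have qu : m q * m (p `|` q)%O = m q by rewrite -mM joinC joinKI.
have pq2 : (m p + m q - 2 * m p * m q) * (m p * m q) = 0.
  have -> : (m p + m q - 2 * m p * m q) * (m p * m q) =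
    (m p * m p) * m q + m p * (m q * m q) - 2 * (m p * m p) * (m q * m q).
    by ring.
  by rewrite !m_idem; ring.
have i2 : indic (formal p + formal q + formal (p `&` q)%O) =
    m p + m q - m p * m q.
  have i1 := indicDE _ _ _ _ (indic_formal p) (indic_formal q).
  apply: etrans (indicDE _ _ _ _ i1 (indic_formal _)) _.
  by rewrite mM -[2 * _ * (m p * _)]mulrA pq2; ring.
apply: etrans (indicDE _ _ _ _ i2 (indic_formal _)) _.
have -> : 2 * (m p + m q - m p * m q) * m (p `|` q)%O =
  2 * (m p * m (p `|` q)%O) + 2 * (m q * m (p `|` q)%O) -
  2 * (m p * (m q * m (p `|` q)%O)) by ring.
by rewrite pu qu mM; ring.
Qed.

Let v_relator r : relators r -> forall x, v (x * indic r) = 0.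
Proof.
move=> rr; apply: v_span => g; case: rr => [[x0 _ <-]|[[p q] _ <-]].
  rewrite indic_formal -mM v_m; apply: le_anti.
  rewrite nu_hat_ge0// andbT -(nu_hat_bot mu_adm x0) meetC.
  exact: nu_hat_meet_le.
rewrite indic_fun_join_relator mulrDr !mulrBr -!mM raddfD !raddfB !v_m /=.
have := nu_hat_modular mu_adm (g `&` p)%O (g `&` q)%O.
rewrite -meetUr meetACA meetxx; lra.
Qed.

(** On the generators this is modularity, after distributing g over the join, or
    the vanishing of nu_hat below the minimal idempotent. It passes to the ideal
    because the indicator is multiplicative and the statement is made for all
    multiples x. *)
Lemma v_relations a : a \in relations (X := X) -> forall x, v (x * indic a) = 0.
Proof.
move=> /asboolP[n [r [s [Ss ->]]]].
elim/big_rec: _ => [|i b _ IHb] x; first by rewrite indic_fun0 mulr0 raddf0.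
rewrite (indic_funD_eq half_twice mM
  (indic_funM half_twice mM (r i) (s i)) (erefl (indic b))).
set r' := indic (r i); set s' := indic (s i); set b' := indic b.
have -> : x * (r' * s' + b' - 2 * (r' * s') * b') =
    (x * r') * s' + x * b' - (x * (2 * (r' * s'))) * b' by ring.
by rewrite raddfB raddfD /= !IHb v_relator// !addr0 subr0.
Qed.

(** The indicator of a symmetric difference with a relation differs from the
    original one by a multiple of the indicator of the relation. *)
Lemma v_indic_class a b : Lc_class a = Lc_class b -> v (indic a) = v (indic b).
Proof.
move=> /Lc_classP ab.
have -> : indic a = indic (a - b + b) by rewrite subrK.
rewrite (indic_funD half_twice mM) raddfB raddfD /=.
have -> : v (indic (a - b)) = 0 by rewrite -[indic _]mul1r v_relations.
have -> : 2 * indic (a - b) * indic b = 2 * indic b * indic (a - b) by ring.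
by rewrite v_relations// add0r subr0.
Qed.

Let v1 : v 1 = 1.
Proof. by rewrite -m1 v_m nu_hat_top. Qed.

(** Inclusion-exclusion: the product of the 1 - f, for f in s, is the indicator of
    the complement of their join j. *)
Let v_minus_join (x0 : X) (s : seq (idem X)) : exists j, forall g,
  v (m g * \prod_(f <- s) (1 - m f)) = nu_hat mu g - nu_hat mu (g `&` j)%O.
Proof.
elim: s => [|f s [j IHj]].
  exists (idem_bot x0) => g; rewrite big_nil mulr1 v_m.
  suff -> : nu_hat mu (g `&` idem_bot x0)%O = 0 by rewrite subr0.
  apply: le_anti; rewrite nu_hat_ge0// andbT -(nu_hat_bot mu_adm x0) meetC.
  exact: nu_hat_meet_le.
exists (f `|` j)%O => g; rewrite big_cons mulrA mulrBr mulr1 mulrBl -mM raddfB /=.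
rewrite !IHj; have := nu_hat_modular mu_adm (g `&` f)%O (g `&` j)%O.
rewrite -meetUr meetACA meetxx meetA; lra.
Qed.

(** The factors 1 - f record the part of the space to which the estimate is
    localized. Removing k from s splits that part in two according to k; the sign
    factor of k is 1 on the part outside k and -1 on the part inside k, so the
    two estimates add up. *)
Let v_sign_le (x0 : X) b (s t : seq (idem X)) g :
  `|v (m g * \prod_(f <- t) (1 - m f) *
     \prod_(k <- s) (if b@_k then 1 - 2 * m k else 1))| <=
  v (m g * \prod_(f <- t) (1 - m f)).
Proof.
elim: s t g => [|k s IHs] t g.
  rewrite big_nil mulr1 ger0_norm//; have [j ->] := v_minus_join x0 t.
  by rewrite subr_ge0 nu_hat_meet_le.
rewrite big_cons; case: ifP => _; last by rewrite mul1r.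
set T := \prod_(_ <- s) _; set P := \prod_(_ <- t) _.
have -> : m g * P * ((1 - 2 * m k) * T) =
    m g * ((1 - m k) * P) * T - (m g * m k) * P * T by ring.
have -> : v (m g * P) = v (m g * ((1 - m k) * P)) + v (m g * m k * P).
  by rewrite -raddfD /=; congr (v _); ring.
rewrite raddfB /=; apply: le_trans (ler_normB _ _) _; apply: lerD.
  by have := IHs (k :: t) g; rewrite big_cons.
by rewrite -mM; exact: IHs.
Qed.

Lemma v_sign_bound (x0 : X) a : `|v (sgn a)| <= 1.
Proof.
have := @v_sign_le x0 a (msupp a) [::] \top%O.
by rewrite big_nil mulr1 m1 mul1r v1.
Qed.

Let two_indic a : v (indic a) *+ 2 = 1 - v (sgn a).
Proof.
rewrite -raddfMn /= -mulr_natl /indic_fun mulrA half_twice mul1r raddfB /=.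
by rewrite v1.
Qed.

Lemma v_indic_ge0 (x0 : X) a : 0 <= v (indic a).
Proof.
have := v_sign_bound x0 a; rewrite ler_norml => /andP[_].
by have := two_indic a; lra.
Qed.

(** Expanding the product of the 1 - 2 e_i over the subsets J of the indices gives
    the terms of the defining formula; the empty subset contributes the constant
    1 that the passage from sign to indicator removes. *)
Lemma nu_sumE n (e : 'I_n -> idem X) :
  v (indic (\sum_i formal (e i))) = nu_sum mu e.
Proof.
have vX k x : v ((- 2) ^+ k * x) = (- 2) ^+ k * v x.
  elim: k => [|k IHk]; first by rewrite !mul1r.
  by rewrite !exprS -!mulrA !mulNr raddfN !mulr_natl raddfMn /= IHk.
have sgnE : v (sgn (\sum_i formal (e i))) =
    \sum_(J : {set 'I_n}) (- 2) ^+ #|J| * nu_hat mu (\meet_(j in J) e j)%O.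
  rewrite (big_morph sgn (sign_funD mM) (sign_fun0 m)).
  under eq_bigr do rewrite sign_fun_formal addrC -mulNr.
  rewrite bigA_distr raddf_sum; apply: eq_bigr => J _ /=.
  rewrite -big_mkcond /= big_split prodr_const /= vX.
  by rewrite -(big_morph m mM m1) v_m.
have := two_indic (\sum_i formal (e i)); rewrite sgnE (bigD1 finset.set0)//=.
rewrite cards0 expr0 mul1r big_set0 nu_hat_top// => h.
have {}h : v (indic (\sum_i formal (e i))) *+ 2 =
   - \sum_(J : {set 'I_n} | J != finset.set0)
       (- 2) ^+ #|J| * nu_hat mu (\meet_(j in J) e j)%O.
  by rewrite h; lra.
suff : nu_sum mu e *+ 2 = - \sum_(J : {set 'I_n} | J != finset.set0)
       (- 2) ^+ #|J| * nu_hat mu (\meet_(j in J) e j)%O.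
  by move: h; lra.
rewrite /nu_sum big_add1 big_mkord; under eq_bigr do rewrite mulr_sumr.
rewrite (exchange_big_dep (fun J => J != finset.set0)) /=; last first.
  by move=> i J _; rewrite -card_gt0 => /eqP ->.
rewrite -sumrMnl -sumrN; apply: eq_bigr => J J0.
have Jn : (#|J|.-1 < n)%N.
  by rewrite prednK ?card_gt0// -[leqRHS]card_ord max_card.
rewrite (big_pred1 (Ordinal Jn)) => [|i]; last first.
  apply/eqP/eqP => [Ji|->]; first by apply: val_inj; rewrite /= Ji.
  by rewrite /= prednK ?card_gt0.
rewrite /= -[in RHS](prednK (n := #|J|)) ?card_gt0// exprS; lra.
Qed.

Lemma Lc_class_sum n (e : 'I_n -> idem X) :
  Lc_class (\sum_i formal (e i)) = \sum_i Lc_of (e i).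
Proof.
apply: (big_morph _ (@Lc_classD R X)).
by apply: (@addrI _ (Lc_class 0)); rewrite -Lc_classD !addr0.
Qed.

Lemma formal_sumsP a : exists n (e : 'I_n -> idem X), a = \sum_i formal (e i).
Proof.
elim/formal_sums_ind: a => [|f _ [n [e ->]]].
  by exists 0%N, (fun=> \top%O); rewrite big_ord0.
exists n.+1, (fun i => oapp e f (unlift ord0 i)).
rewrite big_ord_recl unlift_none; congr (_ + _); apply: eq_bigr => i _.
by rewrite liftK.
Qed.

Lemma nu_barE a : nu_bar mu (Lc_class a) = v (indic a).
Proof.
rewrite /nu_bar; apply: xget_unique.
  have [n [e ae]] := formal_sumsP a; exists n, e.
  by rewrite -Lc_class_sum -ae -nu_sumE -ae.
move=> _ [n [e [ae ->]]]; rewrite -nu_sumE; apply: v_indic_class.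
by rewrite Lc_class_sum.
Qed.

(** For disjoint x and y the indicator of x + y is the sum of the two indicators,
    up to a multiple of the indicator of a relation. *)
Lemma nu_bar_content (x0 : X) :
  [/\ nu_bar mu 1 = 1, forall x, 0 <= nu_bar mu x &
      forall x y, x * y = 0 -> nu_bar mu (x + y) = nu_bar mu x + nu_bar mu y].
Proof.
split.
- have -> : (1 : Lc X) = Lc_class (formal \top%O) by [].
  by rewrite nu_barE indic_formal m1.
- by elim/(@Lc_ind R X) => a; rewrite nu_barE; exact: v_indic_ge0.
elim/(@Lc_ind R X) => a; elim/(@Lc_ind R X) => b ab0.
have {}ab0 : v (indic a * indic b) = 0.
  rewrite -(indic_funM half_twice mM) -[X in v X]mul1r; apply: v_relations.
  have : Lc_class (a * b) = Lc_class 0.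
    rewrite -Lc_mulE; apply: etrans ab0 _.
    by apply: (@addrI _ (Lc_class 0)); rewrite -Lc_classD !addr0.
  by move/Lc_classP; rewrite subr0.
rewrite -Lc_classD !nu_barE (indic_funD half_twice mM) raddfB raddfD /=.
by rewrite -mulrA mulr_natl raddfMn ab0 mul0rn subr0.
Qed.

End Valuation.

Section NuBar.
Variables (R : realType) (X : metricType R) (mu : set X -> R).
Hypothesis mu_adm : admissible_measure mu.

(** In the empty space the empty set would have mass both 0 and 1. *)
Lemma admissible_inhabited : exists x0 : X, True.
Proof.
have [_ _ [mu0 mu1] _ _] := mu_adm.
have : [set: X] !=set0.
  by apply/set0P/eqP => X0; move: mu1; rewrite X0 mu0 => /eqP; rewrite eq_sym oner_eq0.
by move=> [x _]; exists x.
Qed.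

Lemma nu_bar_is_content :
  [/\ nu_bar mu 1 = 1, forall x, 0 <= nu_bar mu x &
      forall x y, x * y = 0 -> nu_bar mu (x + y) = nu_bar mu x + nu_bar mu y].
Proof.
have [x0 _] := admissible_inhabited.
apply: (@nu_bar_content R X mu mu_adm {malg R[idem X]} (2^-1)%:MP
  (fun e => << e >>) _ _ _ (mmap idfun (nu_hat mu))) x0.
- by rewrite -[2]mpolyC_nat -mpolyCM divff.
- by move=> e g; apply/esym; rewrite [LHS]fgmulUU mulr1.
- by [].
- by move=> e; apply: etrans (mmapU _ _) _; rewrite mul1r.
- move=> y vy x; rewrite [x]monalgE mulr_suml raddf_sum big1// => k _ /=.
  by rewrite monalgU_scale -scalerAl mmap_scale vy mulr0.
Qed.

End NuBar.

(** * Separation by homomorphisms of a Boolean ring *)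

Section BooleanPrimeIdeal.
Variable B : comPzRingType.
Hypothesis mulxx : forall x : B, x * x = x.

Lemma boolean_addxx (x : B) : x + x = 0.
Proof.
have := mulxx (x + x); rewrite mulrDl !mulrDr !mulxx => /eqP.
by rewrite -subr_eq0 addrK => /eqP.
Qed.

Lemma boolean_opp (x : B) : - x = x.
Proof. by apply/esym/eqP; rewrite -subr_eq0 opprK boolean_addxx. Qed.

Definition is_ideal (I : set B) : Prop :=
  [/\ I 0, forall x y, I x -> I y -> I (x + y) & forall x y, I y -> I (x * y)].

(** Zorn's lemma is applied to the sets S such that J together with S is an ideal
    avoiding a, so that the union of the empty chain, which is empty, qualifies. *)
Lemma maximal_avoiding_ideal (J : set B) (a : B) : is_ideal J -> ~ J a ->
  exists I, [/\ is_ideal I, J `<=` I, ~ I a &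
    forall I', is_ideal I' -> I `<=` I' -> ~ I' a -> I' `<=` I].
Proof.
move=> idJ Ja; pose P (S : set B) := is_ideal (J `|` S) /\ ~ (J `|` S) a.
have [F FP totF|M [[idM Ma] maxM]] := @Zorn_bigcup B P.
  split; last by move=> [//|[S /FP[_ Sa] aS]]; apply: Sa; right.
  have [J0 JD JM] := idJ; split; first by left.
    have FJ S : F S -> is_ideal (J `|` S) by move=> /FP[].
    have FD S x y : F S -> (J `|` S) x -> (J `|` S) y ->
        (J `|` \bigcup_(S in F) S) (x + y).
      move=> FS Sx Sy; have [_ D _] := FJ _ FS.
      by have [|Sxy] := D _ _ Sx Sy; [left|right; exists S].
    move=> x y [Jx|[S FS Sx]] [Jy|[S' FS' Sy]].
    - by left; exact: JD.
    - by apply: (FD S') => //; [left|right].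
    - by apply: (FD S) => //; [right|left].
    - have [SS'|S'S] := totF _ _ FS FS'.
        by apply: (FD S') => //; right => //; exact: SS'.
      by apply: (FD S) => //; right => //; exact: S'S.
  move=> x y [Jy|[S FS Sy]]; first by left; exact: JM.
  have [[_ _ SM] _] := FP _ FS.
  by have [|] := SM x y (or_intror Sy); [left|right; exists S].
exists (J `|` M); split => //.
move=> I' idI' MI' I'a; apply: contrapT => I'M.
apply: (maxM I'); last by rewrite /P setUidr// => x Jx; apply: MI'; left.
split; first by move=> x Mx; apply: MI'; right.
by move=> I'M'; apply: I'M => x /I'M'; right.
Qed.

(** An ideal I maximal among those containing J and avoiding a contains x or 1 - x
    for every x: otherwise both enlargements of I contain a, and then so does I,
    as x (1 - x) = 0. Hence the quotient by I has two elements. *)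
Lemma boolean_separation (J : set B) (a : B) : is_ideal J -> ~ J a ->
  exists phi : {rmorphism B -> bool}, phi a = 1 /\ forall x, J x -> phi x = 0.
Proof.
move=> idJ Ja; have [I [idI JI Ia maxI]] := maximal_avoiding_ideal idJ Ja.
have [I0 ID IM] := idI.
have dich x : I x \/ I (1 - x).
  pose ext z := [set y | exists2 i, I i & exists b, y = i + b * z].
  have ext_ideal z : is_ideal (ext z).
    split; first by exists 0 => //; exists 0; rewrite mul0r addr0.
      move=> _ _ [i Ii [b ->]] [j Ij [c ->]]; exists (i + j); first exact: ID.
      by exists (b + c); rewrite mulrDl addrACA.
    move=> y _ [i Ii [b ->]]; exists (y * i); first exact: IM.
    by exists (y * b); rewrite mulrDr mulrA.
  have I_ext z : I `<=` ext z.
    by move=> i Ii; exists i => //; exists 0; rewrite mul0r addr0.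
  have ext_self z : ext z z by exists 0 => //; exists 1; rewrite mul1r add0r.
  have ext_a z : ~ I z -> ext z a.
    move=> Iz; apply: contrapT => za; apply: Iz.
    exact: (maxI _ (ext_ideal z) (@I_ext z) za).
  have [|Ix] := pselect (I x); first by left.
  have [|I1x] := pselect (I (1 - x)); first by right.
  have [i Ii [b ai]] := ext_a _ Ix; have [j Ij [c aj]] := ext_a _ I1x.
  have xC0 : (1 - x) * x = 0 by rewrite mulrBl mul1r mulxx subrr.
  case: Ia; rewrite (_ : a = (1 - x) * i + x * j); first by apply: ID; exact: IM.
  have -> : (1 - x) * i = (1 - x) * a.
    by rewrite ai mulrDr [_ * (b * x)]mulrCA xC0 mulr0 addr0.
  have -> : x * j = x * a.
    by rewrite aj mulrDr [_ * (c * _)]mulrCA [x * (1 - x)]mulrC xC0 mulr0 addr0.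
  by rewrite -mulrDl subrK mul1r.
have I1 : ~ I 1 by move=> I1; apply: Ia; rewrite -[a]mulr1; exact: IM.
pose f x := ~~ `[< I x >].
have f0 x : I x -> f x = 0 by move=> Ix; rewrite /f asboolT.
have f1 x : I (1 - x) -> f x = 1.
  move=> I1x; rewrite /f asboolF// => Ix; apply: I1; rewrite -(subrK x 1).
  exact: ID.
have fB : zmod_morphism f.
  move=> x y; rewrite boolean_opp.
  have [Ix|Ix] := dich x; have [Iy|Iy] := dich y.
  - by rewrite !f0//; exact: ID.
  - rewrite f1 ?(f0 x) ?(f1 y)//.
    by rewrite opprD addrCA boolean_opp; exact: ID.
  - rewrite f1 ?(f0 y) ?(f1 x)//.
    by rewrite opprD addrA [- y]boolean_opp; exact: ID.
  - rewrite f0 ?(f1 y) ?(f1 x)//.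
    have := ID _ _ Ix Iy; rewrite addrACA boolean_addxx add0r.
    by rewrite -opprD boolean_opp.
have fM : monoid_morphism f.
  split; first by rewrite f1// subrr.
  move=> x y; have [Ix|Ix] := dich x.
    by rewrite !(f0 x)// f0 ?mul0r// mulrC; exact: IM.
  have [Iy|Iy] := dich y; first by rewrite !(f0 y)// f0 ?mulr0//; exact: IM.
  rewrite (f1 x)// (f1 y)// f1//.
  rewrite (_ : 1 - x * y = (1 - x) + x * (1 - y)); last first.
    by rewrite mulrBr mulr1 addrA subrK.
  by apply: ID => //; exact: IM.
pose phi : {rmorphism B -> bool} := HB.pack f
  (GRing.isZmodMorphism.Build _ _ f fB) (GRing.isMonoidMorphism.Build _ _ f fM).
exists phi; split; last by move=> x /JI; exact: f0.
by apply: f1; have [] := dich a.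
Qed.

End BooleanPrimeIdeal.

(** * The Stone space and its clopen sets *)

Section StoneSpace.
Variables (R : realType) (X : metricType R).
Implicit Types (a b x : Lc X) (S : set (Lc X)) (phi : stone X).

Local Notation U := (@stone_clopen R X).

Lemma formal_sums_addxx (a : formal_sums X) : a + a = 0.
Proof. by apply/malgP => k; rewrite mcoeffD mcoeff0; case: (a@_k). Qed.

Lemma formal_sums_mulxx (a : formal_sums X) : a * a = a.
Proof.
elim/formal_sums_ind: a => [|e a IHa]; first exact: mul0r.
have -> : (formal e + a) * (formal e + a) =
    formal e * formal e + a * a + (formal e * a + formal e * a) by ring.
by rewrite -formalM meetxx IHa formal_sums_addxx addr0.
Qed.

Lemma Lc_mulxx (x : Lc X) : x * x = x.
Proof.
elim/(@Lc_ind R X): x => a; apply: etrans (Lc_mulE _ _) _.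
by rewrite formal_sums_mulxx.
Qed.

Lemma stone_evalM phi a b : stone_eval phi (a * b) = stone_eval phi a * stone_eval phi b.
Proof. exact: rmorphM. Qed.

Lemma stone_eval1 phi : stone_eval phi 1 = 1.
Proof. exact: rmorph1. Qed.

Lemma stone_clopen0 : U 0 = set0.
Proof.
by apply/seteqP; split => // phi; rewrite /stone_clopen /= /stone_eval rmorph0.
Qed.

Lemma stone_clopenM a b : U (a * b) = U a `&` U b.
Proof.
apply/seteqP; split => phi; rewrite /stone_clopen /= stone_evalM.
  by case: (stone_eval phi a); case: (stone_eval phi b).
by move=> [-> ->].
Qed.

Lemma stone_clopenC a : U (1 - a) = ~` U a.
Proof.
apply/seteqP; split => phi; rewrite /stone_clopen /= /stone_eval rmorphB rmorph1.
  by case: (phi a).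
by case: (phi a).
Qed.

Lemma stone_clopen1 : U 1 = setT.
Proof. by apply/seteqP; split => // phi _; exact: stone_eval1. Qed.

Lemma stone_clopenU a b : U (1 - (1 - a) * (1 - b)) = U a `|` U b.
Proof. by rewrite stone_clopenC stone_clopenM !stone_clopenC setCI !setCK. Qed.

(** Otherwise a lies outside the ideal generated by S, which consists of the x
    with x (1 - s_1) ... (1 - s_n) = 0 for some s_i in S, and a homomorphism that
    kills S but not a is a point of the clopen set of a that is not covered. *)
Lemma stone_compact S a : U a `<=` \bigcup_(s in S) U s ->
  exists2 l : seq (Lc X), (forall s, s \in l -> S s) &
    U a `<=` \bigcup_(s in [set` l]) U s.
Proof.
move=> aS; pose J x := exists2 l : seq (Lc X), (forall s, s \in l -> S s) &
  x * \prod_(s <- l) (1 - s) = 0.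
have idJ : is_ideal J.
  split; first by exists [::] => //; rewrite mul0r.
    move=> x y [l lS xl] [l' l'S yl']; exists (l ++ l').
      by move=> s; rewrite mem_cat => /orP[/lS|/l'S].
    by rewrite big_cat mulrDl /= mulrA xl mul0r add0r mulrCA yl' mulr0.
  by move=> x y [l lS yl]; exists l => //; rewrite -mulrA yl mulr0.
have [l lS al] : J a.
  apply: contrapT => Ja.
  have [phi [phia phiJ]] := boolean_separation Lc_mulxx idJ Ja.
  have [s Ss phis] := aS phi phia.
  have : phi s = 0.
    apply: phiJ; exists [:: s]; first by move=> t; rewrite inE => /eqP ->.
    by rewrite big_seq1 mulrBr mulr1 Lc_mulxx subrr.
  by move: phis; rewrite /stone_clopen /= /stone_eval => ->.
exists l => // phi phia; apply: contrapT => phil.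
have : stone_eval phi (a * \prod_(s <- l) (1 - s)) = 0.
  by rewrite al; exact: rmorph0.
rewrite stone_evalM phia mul1r => /eqP; apply/negP.
have -> : stone_eval phi (\prod_(s <- l) (1 - s)) = 1; last by [].
rewrite /stone_eval rmorph_prod big_seq big1// => s sl.
rewrite rmorphB rmorph1.
suff -> : (phi : {rmorphism Lc X -> bool}) s = 0 by rewrite subr0.
apply: contrapT => phis; apply: phil; exists s => //.
rewrite /stone_clopen /= /stone_eval.
by move: phis; case: (phi s).
Qed.

(** If a is not below b, then a homomorphism can kill the annihilator of 1 - b,
    which contains b, but not a. *)
Lemma stone_clopen_inj : injective U.
Proof.
suff H a b : U a `<=` U b -> a = a * b.
  move=> a b ab; rewrite (H a b) ?ab//.
  by rewrite [RHS](H b a) ?ab// mulrC.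
move=> ab; apply/eqP; rewrite -subr_eq0 -{1}[a]mulr1 -mulrBr; apply/eqP.
pose J x := x * (1 - b) = 0.
have idJ : is_ideal J.
  split; first by rewrite /J mul0r.
    by move=> x y; rewrite /J mulrDl => -> ->; rewrite addr0.
  by move=> x y; rewrite /J -mulrA => ->; rewrite mulr0.
apply: contrapT => Ja.
have [phi [phia phiJ]] := boolean_separation Lc_mulxx idJ Ja.
have := ab phi phia; rewrite /stone_clopen /= /stone_eval phiJ//.
by rewrite /J mulrBr mulr1 Lc_mulxx subrr.
Qed.

Lemma stone_clopen_clopen a : clopen (U a).
Proof.
have cts : continuous (fun phi => stone_eval phi a).
  move=> phi; apply: (@continuous_comp _ _ _ (@stone_eval R X)
    (fun f : {ptws Lc X -> bool} => f a)).
    exact: initial_continuous.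
  exact: (@proj_continuous _ (fun=> bool)).
have -> : U a = (fun phi => stone_eval phi a) @^-1` [set 1].
  by [].
apply: clopen_comp => //.
split; [exact: discrete_open|exact: discrete_closed].
Qed.

(** The basic clopen sets containing phi generate a filter, which converges to phi
    because it does so coordinatewise. *)
Lemma stone_nbhs phi (A : set (stone X)) : nbhs phi A ->
  exists2 a, U a phi & U a `<=` A.
Proof.
pose F := filter_from [set a | U a phi] U.
have FF : Filter F.
  apply: filter_from_filter; first by exists 1; exact: stone_eval1.
  move=> a b Ua Ub; exists (a * b); last by rewrite stone_clopenM.
  by rewrite /= stone_clopenM.
suff : F --> phi by move=> Fphi /Fphi.
move=> {}A [_ [[B oB <-] Bphi] BA].
have : nbhs (stone_eval phi : {ptws Lc X -> bool}) B by exact: open_nbhs_nbhs.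
have Fphi : (@stone_eval R X) @ F --> (stone_eval phi : {ptws Lc X -> bool}).
  apply/cvg_sup => t C [_ [[V _ <-] /= Vt] VC].
  have [phit|phit] : U t phi \/ U (1 - t) phi.
  - by have [?|?] := pselect (U t phi); [left|right; rewrite stone_clopenC].
  - exists t => // psi psit; apply: VC => /=.
    by move: phit psit Vt; rewrite /stone_clopen /= => -> ->.
  - exists (1 - t) => // psi psit; apply: VC => /=.
    move: phit psit Vt; rewrite stone_clopenC /stone_clopen /=.
    by case: (stone_eval phi t) => // _; case: (stone_eval psi t).
by move=> /Fphi; exact: filterS BA.
Qed.

(** The whole space is covered by the basic clopen sets contained either in A or in
    its complement; those of a finite subcover that lie in A have union A. *)
Lemma clopen_stoneP (A : set (stone X)) : clopen A -> exists a, A = U a.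
Proof.
move=> [oA cA].
have AP (C : set (stone X)) phi : open C -> C phi -> exists2 a, U a phi & U a `<=` C.
  by move=> oC Cphi; apply: stone_nbhs; exact: open_nbhs_nbhs.
pose S := [set a | U a `<=` A \/ U a `<=` ~` A].
have [phi _|l lS Tl] := @stone_compact S 1.
  have [/(AP _ _ oA)[a aphi aA]|nAphi] := pselect (A phi).
    by exists a => //; left.
  have [a aphi aA] := AP _ _ (closed_openC cA) nAphi.
  by exists a => //; right.
suff [a aE] : exists a, U a = \bigcup_(s in [set s | s \in l /\ U s `<=` A]) U s.
  exists a; rewrite aE; apply/seteqP; split => [phi Aphi|phi [s [_ sA] /sA//]].
  have [|s /= sl sphi] := Tl phi; first by rewrite stone_clopen1.
  exists s => //; split => //.
  by have [//|sA] := lS s sl; case: (sA phi sphi Aphi).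
elim: l {lS Tl} => [|s l [a aE]].
  by exists 0; rewrite stone_clopen0; apply/seteqP; split => // phi [s []].
have [sA|sA] := pselect (U s `<=` A).
  exists (1 - (1 - s) * (1 - a)); rewrite stone_clopenU aE.
  apply/seteqP; split => phi.
    move=> [sphi|[t [tl tA] tphi]]; first by exists s => //; rewrite /= mem_head.
    by exists t => //; rewrite /= in_cons tl orbT.
  move=> [t [+ tA] tphi]; rewrite in_cons => /orP[/eqP ts|tl].
    by left; rewrite -ts.
  by right; exists t.
exists a; rewrite aE; apply/seteqP; split => phi [t [+ tA] tphi].
  by move=> tl; exists t => //; rewrite /= in_cons tl orbT.
rewrite in_cons => /orP[/eqP ts|tl]; first by case: sA; rewrite -ts.
by exists t.
Qed.

End StoneSpace.

(** * Extension of finitely additive functions on compact set algebras *)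

(** An alias of T on which the algebra of sets G can be declared. The hypotheses on G
    are arguments so that the structure can be inferred from the alias. *)
Definition algebra_type (T : Type) (G : set (set T)) of
  G set0 & setU_closed G & setC_closed G : Type := T.

Section AlgebraType.
Variables (T : pointedType) (G : set (set T)).
Hypotheses (G0 : G set0) (GU : setU_closed G) (GC : setC_closed G).

HB.instance Definition _ := Pointed.copy (algebra_type G0 GU GC) T.
HB.instance Definition _ := isAlgebraOfSets.Build default_measure_display
  (algebra_type G0 GU GC) G0 GU GC.

End AlgebraType.

Section CompactContent.
Variables (R : realType) (T : pointedType) (G : set (set T)).
Hypotheses (G0 : G set0) (GU : setU_closed G) (GC : setC_closed G).
Variable p : set T -> R.
Hypothesis p_ge0 : forall A, 0 <= p A.
Hypothesis p_additive : forall A B, G A -> G B -> A `&` B = set0 ->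
  p (A `|` B) = p A + p B.
Hypothesis G_compact : forall A (F : (set T)^nat), G A -> (forall n, G (F n)) ->
  A `<=` \bigcup_n F n -> exists N, A `<=` \bigcup_(n < N) F n.

Local Notation T' := (algebra_type G0 GU GC).

Let p' (A : set T') : \bar R := (p A)%:E.

Let p0 : p set0 = 0.
Proof.
have := p_additive G0 G0 (set0I _); rewrite setU0 => /esym/eqP.
by rewrite -subr_eq0 addrK => /eqP.
Qed.

Let p'0 : p' set0 = 0%E.
Proof. by rewrite /p' p0. Qed.

Let p'_ge0 A : (0 <= p' A)%E.
Proof. by rewrite lee_fin. Qed.

Let p_bigsetU (F : (set T)^nat) N : (forall n, G (F n)) -> trivIset setT F ->
  G (\big[setU/set0]_(i < N) F i) /\
  p (\big[setU/set0]_(i < N) F i) = \sum_(i < N) p (F i).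
Proof.
move=> GF tF; elim: N => [|N [IH1 IH2]]; first by rewrite !big_ord0.
rewrite !big_ord_recr /=; split; first exact: GU.
rewrite p_additive// ?IH2//.
apply: (@trivIset_bigsetUI _ xpredT F _ N N) => //.
exact: sub_trivIset tF.
Qed.

(** If a disjoint union of members of G lies in G, then compactness leaves only
    finitely many nonempty terms. *)
Let p'_sigma : semi_sigma_additive p'.
Proof.
move=> F GF tF GUF.
have [N UN] := G_compact GUF GF (@subset_refl _ _).
have F0 n : (N <= n)%N -> F n = set0.
  move=> Nn; rewrite -subset0 => t Fnt.
  have [m /= mN Fmt] := UN t (ex_intro2 _ _ n I Fnt).
  have mn : m = n by apply: tF => //; exists t.
  by move: mN; rewrite mn ltnNge Nn.
have UE n : (N <= n)%N -> \bigcup_n F n = \big[setU/set0]_(i < n) F i.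
  move=> Nn; rewrite -bigcup_mkord; apply/seteqP; split => [t /UN[m /= mN Fmt]|].
    by exists m => //=; exact: leq_trans mN Nn.
  by move=> t [m _ Fmt]; exists m.
apply: cvg_near_cst; exists N => // n /= Nn.
by rewrite /p' (UE n Nn) (p_bigsetU n GF tF).2 big_mkord sumEFin.
Qed.

HB.instance Definition _ := isMeasure.Build _ _ _ p' p'0 p'_ge0 p'_sigma.

(** By the previous fact p is a premeasure, so its outer measure is a measure on
    the generated sigma-algebra and extends p. *)
Lemma compact_content_extension : exists nu : set T -> \bar R,
  sigma_additive_measure <<s G>> nu /\ forall A, G A -> nu A = (p A)%:E.
Proof.
exists (measure_extension (p' : {measure set T' -> \bar R})); split; last first.
  by move=> A GA; exact: measurable_mu_extE.
split => // F GF tF.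
have mS := @measure_sigma_additive _ _ _ (measure_extension (p' : {measure set T' -> \bar R})).
exact: (mS F GF tF).
Qed.

End CompactContent.

Section Uniqueness.
Variables (R : realType) (T : pointedType) (G : set (set T)).

(** Outside the sigma-algebra the two functions are arbitrary; taking absolute
    values makes them nonnegative everywhere, as measures are required to be,
    without changing them on the sigma-algebra. *)
Lemma sigma_additive_measure_unique (nu1 nu2 : set T -> \bar R) :
  G setT -> setI_closed G ->
  sigma_additive_measure <<s G>> nu1 -> sigma_additive_measure <<s G>> nu2 ->
  (forall A, G A -> nu1 A = nu2 A) -> (nu1 setT < +oo)%E ->
  forall A, <<s G>> A -> nu1 A = nu2 A.
Proof.
move=> GT GI nu1P nu2P nu12 nu1T.
pose abs_measure nu (A : set (g_sigma_algebraType G)) : \bar R := `|nu A|%E.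
have abs_ge0 nu A : (0 <= abs_measure nu A)%E by exact: abse_ge0.
have absE nu : sigma_additive_measure <<s G>> nu ->
    forall A, <<s G>> A -> abs_measure nu A = nu A.
  by move=> [_ nu_ge0 _] A GA; rewrite /abs_measure gee0_abs// nu_ge0.
have abs0 nu : sigma_additive_measure <<s G>> nu -> abs_measure nu set0 = 0%E.
  by move=> [nu0 _ _]; rewrite /abs_measure nu0 abse0.
have absS nu : sigma_additive_measure <<s G>> nu ->
    semi_sigma_additive (abs_measure nu).
  move=> nuP F GF tF GUF; have [_ _ nuS] := nuP.
  rewrite absE//; have := nuS F GF tF; apply: cvg_trans; apply: near_eq_cvg.
  by apply: nearW => n; apply: eq_bigr => i _; rewrite absE//; exact: GF.
pose m1 : {measure set (g_sigma_algebraType G) -> \bar R} := HB.pack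
  (abs_measure nu1) (isMeasure.Build _ _ _ (abs_measure nu1) (abs0 _ nu1P)
  (abs_ge0 nu1) (absS _ nu1P)).
pose m2 : {measure set (g_sigma_algebraType G) -> \bar R} := HB.pack
  (abs_measure nu2) (isMeasure.Build _ _ _ (abs_measure nu2) (abs0 _ nu2P)
  (abs_ge0 nu2) (absS _ nu2P)).
have Gs A : G A -> <<s G>> A by exact: sub_sigma_algebra.
move=> A GA; rewrite -(absE _ nu1P)// -(absE _ nu2P)//.
apply: (@g_sigma_algebra_measure_unique _ R (g_sigma_algebraType G) G Gs
  (fun=> setT) (fun=> GT) _ m1 m2) => //.
- by apply: bigcup_const.
- by move=> B GB /=; rewrite !absE ?nu12//; exact: Gs.
- by move=> k /=; rewrite absE//; exact: Gs.
Qed.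

End Uniqueness.

(** * The measure on the Stone space *)

Section StoneMeasure.
Variables (R : realType) (X : metricType R).
Local Notation U := (@stone_clopen R X).

Lemma clopen_stoneE : [set A : set (stone X) | clopen A] = range U.
Proof.
apply/seteqP; split => A; first by move=> /clopen_stoneP[a ->]; exists a.
by move=> [a _ <-]; exact: stone_clopen_clopen.
Qed.

Lemma range_stone0 : range U set0.
Proof. by exists 0 => //; exact: stone_clopen0. Qed.

Lemma range_stoneU : setU_closed (range U).
Proof.
move=> _ _ [a _ <-] [b _ <-]; exists (1 - (1 - a) * (1 - b)) => //.
exact: stone_clopenU.
Qed.

Lemma range_stoneI : setI_closed (range U).
Proof.
by move=> _ _ [a _ <-] [b _ <-]; exists (a * b) => //; exact: stone_clopenM.
Qed.

Lemma range_stoneC : setC_closed (range U).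
Proof. by move=> _ [a _ <-]; exists (1 - a) => //; exact: stone_clopenC. Qed.

Lemma range_stone_compact A (F : (set (stone X))^nat) :
  range U A -> (forall n, range U (F n)) -> A `<=` \bigcup_n F n ->
  exists N, A `<=` \bigcup_(n < N) F n.
Proof.
move=> [a _ <-] FU aF; pose S := [set s | exists n, F n = U s].
have [phi /aF[n _ Fn]|l lS al] := @stone_compact R X S a.
  by have [s _ sF] := FU n; exists s; [exists n|rewrite sF].
suff [N NF] : exists N, forall s, s \in l -> exists2 n, (n < N)%N & F n = U s.
  exists N => phi /al[s /NF[n nN nF] sphi]; exists n => //.
  by rewrite nF.
elim: l lS {al} => [|s l IHl] lS; first by exists 0%N.
have [t tl|N NF] := IHl; first by apply: lS; rewrite in_cons tl orbT.
have [n nF] : S s by apply: lS; rewrite mem_head.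
exists (maxn N n.+1) => t; rewrite in_cons => /orP[/eqP ->|/NF[k kN kF]].
  by exists n => //; rewrite leq_max ltnSn orbT.
by exists k => //; rewrite leq_max kN.
Qed.

End StoneMeasure.

Theorem mainTheorem6 (R : realType) (X : metricType R) (mu : set X -> R)
    (mu_adm : admissible_measure mu) :
  exists nu : set (stone X) -> \bar R,
    [/\ sigma_additive_measure (clopen_sigma_algebra X) nu,
        forall a : Lc X, nu (stone_clopen a) = (nu_bar mu a)%:E &
        forall nu' : set (stone X) -> \bar R,
          sigma_additive_measure (clopen_sigma_algebra X) nu' ->
          (forall a : Lc X, nu' (stone_clopen a) = (nu_bar mu a)%:E) ->
          forall A, clopen_sigma_algebra X A -> nu' A = nu A].
Proof.
have [nb1 nb_ge0 nbD] := nu_bar_is_content mu_adm.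
(* A measurable type needs a point: the Stone space has one as nu_bar 1 = 1 forces
   1 to differ from 0 in L^c(X). *)
have [phi0] : exists phi : stone X, True.
  have nb0 : nu_bar mu 0 = 0.
    have := nbD 0 0 (mul0r _); rewrite addr0 => /esym/eqP.
    by rewrite -subr_eq0 addrK => /eqP.
  have [||phi _] := @boolean_separation (Lc X) (@Lc_mulxx R X) [set 0] 1.
  - split => [//|x y -> ->|x y ->]; [exact: addr0|exact: mulr0].
  - by move=> /= one0; move: nb1; rewrite one0 nb0 => /esym/eqP; rewrite oner_eq0.
  - by exists phi.
move=> _; pose T : pointedType := HB.pack (stone X) (isPointed.Build (stone X) phi0).
pose p (A : set T) := nu_bar mu (xget 0 [set a | A = stone_clopen a]).
have pE a : p (stone_clopen a) = nu_bar mu a.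
  congr (nu_bar mu _); apply: xget_unique => // b ab.
  exact/esym/stone_clopen_inj.
have p_additive A B : range (@stone_clopen R X) A -> range (@stone_clopen R X) B ->
    A `&` B = set0 -> p (A `|` B) = p A + p B.
  move=> [a _ <-] [b _ <-] ab0.
  have {}ab0 : a * b = 0.
    by apply: stone_clopen_inj; rewrite stone_clopenM stone_clopen0.
  rewrite -stone_clopenU !pE -nbD//; congr (nu_bar mu _).
  rewrite (_ : 1 - _ = a + b - a * b); last by ring.
  by rewrite ab0 subr0.
have [nu [nu_sigma nuE]] := @compact_content_extension R T (range (@stone_clopen R X))
  (@range_stone0 R X) (@range_stoneU R X) (@range_stoneC R X) p
  (fun A => nb_ge0 _) p_additive (@range_stone_compact R X).
have nuU a : nu (stone_clopen a) = (nu_bar mu a)%:E by rewrite nuE ?pE//; exists a.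
exists nu; rewrite /clopen_sigma_algebra clopen_stoneE; split => // nu' nu'_sigma nu'U.
apply: (@sigma_additive_measure_unique R T (range (@stone_clopen R X))) => //.
- by exists 1 => //; exact: stone_clopen1.
- exact: range_stoneI.
- by move=> _ [a _ <-]; rewrite nuU nu'U.
- by rewrite -stone_clopen1 nu'U ltry.
Qed.
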